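(* Let $\mathcal{O}$ be the ring of integers of a finite extension $E$ of $\mathbf{Q}_p$, with uniformizer $\varpi$. Let $R$ be a finite local $\mathcal{O}$-algebra which is $\varpi$-torsion free and reduced, and let $\lambda:R\to\mathcal{O}$ be a surjective $\mathcal{O}$-algebra homomorphism. Let $M$ be a reflexive $R$-module of $\lambda$-rank $1$. Then $|\Psi_\lambda(R)|\ge|\Psi_\lambda(M)|$, and hence $\delta_{\lambda,R}(R)\le\delta_{\lambda,R}(M)$. Equality holds if the natural map $R\to\mathrm{End}_R(M)$ is an isomorphism.
   Context: For a finitely generated $R$-module $M$ set $M^*=\mathrm{Hom}_{\mathcal{O}}(M,\mathcal{O})$ with its natural $R$-module structure; $M$ is reflexive if $M\to M^{**}$ is an isomorphism (equivalently $M$ is finitely generated over $\mathcal{O}$ and $\varpi$-torsion free). The $\lambda$-rank of $M$ is $\dim_E (M[\ker\lambda]\otimes_{\mathcal{O}}E)$. The congruence module $\Psi_\lambda(M)$ is the cokernel of the composite $M[\ker\lambda]\to M\xrightarrow{\sim}\mathrm{Hom}_{\mathcal{O}}(M^*,\mathcal{O})\to\mathrm{Hom}_{\mathcal{O}}(M^*[\ker\lambda],\mathcal{O})$. The cotangent space is $\Phi_{\lambda,R}=\ker\lambda/(\ker\lambda)^2$, and for $M$ reflexive of $\lambda$-rank $d>0$ the Wiles defect is $\delta_{\lambda,R}(M)=\dfrac{d\log|\Phi_{\lambda,R}|-\log|\Psi_\lambda(M)|}{d\log|\mathcal{O}/p|}$. *)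

(* Defs.v *)
From HB Require Import structures.
From mathcomp Require Import all_boot all_order all_algebra all_field.
From mathcomp Require Import finmap boolp classical_sets functions cardinality.
From mathcomp Require Import reals exp.

Set Implicit Arguments.
Unset Strict Implicit.
Unset Printing Implicit Defensive.
Import GRing.Theory.

Local Open Scope classical_set_scope.
Local Open Scope ring_scope.

Lemma modz_dvd (m d e : int) : (d %| e)%Z -> ((m %% e)%Z %% d)%Z = (m %% d)%Z.
Proof.
by case/dvdzP=> k ->; rewrite {2}(divz_eq m (k * d)) mulrA modzMDl.
Qed.

(* The ring of p-adic integers, as the inverse limit of the Z/p^n: the n-th
   component of an element is represented by its residue in [0, p^n[. The
   primality proof is a parameter of the type so that the integral domain
   structure can be inferred from it.                                         *)
Definition padic_coherent (p : nat) (p_pr : prime p) (x : nat -> int) : bool :=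
  `[< forall n, (x n.+1 %% Posz (p ^ n)%N)%Z = x n >].

Section PadicIntegers.
Variables (p : nat) (p_pr : prime p).

Local Notation q n := (Posz (p ^ n)%N).

Record padic_int :=
  PadicInt { padic_res :> nat -> int; _ : padic_coherent p_pr padic_res }.

HB.instance Definition _ := [isSub for padic_res].
HB.instance Definition _ := [Choice of padic_int by <:].

Implicit Types x y z : padic_int.

Lemma padic_resS x n : (x n.+1 %% q n)%Z = x n.
Proof. by case: x => x /= /asboolP. Qed.

Lemma padic_res_mod x n : (x n %% q n)%Z = x n.
Proof. by rewrite -{1}padic_resS modz_mod padic_resS. Qed.

Lemma padic_res_le x m n : (m <= n)%N -> (x n %% q m)%Z = x m.
Proof.
move=> /subnK <-; elim: (n - m)%N => [|k IH]; first exact: padic_res_mod.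
rewrite -IH -[in RHS](padic_resS x) addSn modz_dvd //.
by rewrite dvdzE /= dvdn_exp2l // leq_addl.
Qed.

Lemma padic_intP x y : (forall n, x n = y n) -> x = y.
Proof. by move=> e; apply/val_inj/funext. Qed.

Lemma padic_mk_subproof (f : nat -> int) :
  (forall n, (f n.+1 = f n %[mod q n])%Z) ->
  padic_coherent p_pr (fun n => (f n %% q n)%Z).
Proof.
move=> fE; apply/asboolP => n; rewrite modz_dvd //.
by rewrite dvdzE /= dvdn_exp2l.
Qed.

Definition padic_mk f fE := PadicInt (@padic_mk_subproof f fE).

Lemma padic_add_subproof x y n : (x n.+1 + y n.+1 = x n + y n %[mod q n])%Z.
Proof. by rewrite -modzDm !padic_resS. Qed.
Lemma padic_mul_subproof x y n : (x n.+1 * y n.+1 = x n * y n %[mod q n])%Z.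
Proof. by rewrite -modzMm !padic_resS. Qed.
Lemma padic_opp_subproof x n : (- x n.+1 = - x n %[mod q n])%Z.
Proof. by rewrite -modzNm padic_resS. Qed.
Lemma padic_cst_subproof (c : int) n : (c = c %[mod q n])%Z.
Proof. by []. Qed.

Definition padic_add x y := padic_mk (padic_add_subproof x y).
Definition padic_mul x y := padic_mk (padic_mul_subproof x y).
Definition padic_opp x := padic_mk (padic_opp_subproof x).
Definition padic_cst c := padic_mk (padic_cst_subproof c).

Lemma padic_addA : associative padic_add.
Proof. by move=> x y z; apply: padic_intP => n /=; rewrite modzDml modzDmr addrA. Qed.
Lemma padic_addC : commutative padic_add.
Proof. by move=> x y; apply: padic_intP => n /=; rewrite addrC. Qed.
Lemma padic_add0 : left_id (padic_cst 0) padic_add.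
Proof. by move=> x; apply: padic_intP => n /=; rewrite mod0z add0r padic_res_mod. Qed.
Lemma padic_addN : left_inverse (padic_cst 0) padic_opp padic_add.
Proof. by move=> x; apply: padic_intP => n /=; rewrite modzDml addNr. Qed.

HB.instance Definition _ :=
  GRing.isZmodule.Build padic_int padic_addA padic_addC padic_add0 padic_addN.

Lemma padic_mulA : associative padic_mul.
Proof. by move=> x y z; apply: padic_intP => n /=; rewrite modzMml modzMmr mulrA. Qed.
Lemma padic_mulC : commutative padic_mul.
Proof. by move=> x y; apply: padic_intP => n /=; rewrite mulrC. Qed.
Lemma padic_mul1 : left_id (padic_cst 1) padic_mul.
Proof. by move=> x; apply: padic_intP => n /=; rewrite modzMml mul1r padic_res_mod. Qed.
Lemma padic_mulD : left_distributive padic_mul padic_add.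
Proof.
by move=> x y z; apply: padic_intP => n /=; rewrite modzMml modzDm mulrDl.
Qed.
Lemma padic_1neq0 : padic_cst 1 != 0.
Proof.
apply/eqP => /(congr1 (fun x : padic_int => x 1%N)) /=.
by rewrite mod0z expn1 modz_small // ltz_nat prime_gt1.
Qed.

HB.instance Definition _ := GRing.Zmodule_isComNzRing.Build padic_int
  padic_mulA padic_mulC padic_mul1 padic_mulD padic_1neq0.

Definition padic_unit : {pred padic_int} := fun x => `[< exists y, y * x = 1 >].
Definition padic_inv x : padic_int :=
  if pselect (exists y, y * x = 1) is left h then projT1 (cid h) else x.

Lemma padic_mulVx : {in padic_unit, left_inverse 1 padic_inv *%R}.
Proof.
move=> x /asboolP h; rewrite /padic_inv; case: pselect => // h'.
by case: cid.
Qed.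
Lemma padic_unitPl x y : y * x = 1 -> padic_unit x.
Proof. by move=> h; apply/asboolP; exists y. Qed.
Lemma padic_inv_out : {in [predC padic_unit], padic_inv =1 id}.
Proof.
by move=> x /asboolPn h; rewrite /padic_inv; case: pselect.
Qed.

HB.instance Definition _ := GRing.ComNzRing_hasMulInverse.Build padic_int
  padic_mulVx padic_unitPl padic_inv_out.

Lemma padic_neq0 x : x != 0 -> exists n, x n != 0.
Proof.
move=> x0; apply: contrapT => h; case/eqP: x0; apply: padic_intP => n /=.
by rewrite mod0z; apply/eqP/negPn/negP => xn; apply: h; exists n.
Qed.

Lemma padic_idomain x y : x * y = 0 -> (x == 0) || (y == 0).
Proof.
move=> xy0; apply/norP => -[/padic_neq0[m xm] /padic_neq0[n yn]].
move/(congr1 (fun x : padic_int => x (m + n)%N)): xy0 => /=.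
rewrite mod0z => /dvdz_mod0P; rewrite dvdzE abszM /= => dv.
have ndv (z : padic_int) k l : z k != 0 -> (k <= l)%N -> ~~ (p ^ k %| `|z l|)%N.
  move=> zk kl; apply: contra zk => d; rewrite -(padic_res_le z kl).
  exact/eqP/dvdz_mod0P.
have nx := ndv x m (m + n)%N xm (leq_addr _ _).
have ny := ndv y n (m + n)%N yn (leq_addl _ _).
have gt0 k (a : nat) : ~~ (p ^ k %| a)%N -> (0 < a)%N by case: a => [|a _ //]; rewrite dvdn0.
have [ax ay] := (gt0 _ _ nx, gt0 _ _ ny).
move: dv nx ny; rewrite !pfactor_dvdn ?muln_gt0 ?ax ?ay //.
by rewrite lognM // -!ltnNge => h h1 h2; move: (leq_add h1 (ltnW h2)); rewrite addSn ltnNge h.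
Qed.

HB.instance Definition _ :=
  GRing.ComUnitRing_isIntegral.Build padic_int padic_idomain.

Definition padic := {fraction padic_int}.
HB.instance Definition _ := GRing.Field.on padic.

End PadicIntegers.

(* The ring of integers of a finite extension E of Q_p: the integral closure
   of Z_p in E.                                                               *)
Section RingOfIntegers.
Variables (p : nat) (p_pr : prime p) (E : fieldExtType (padic p_pr)).

Definition padic_int_to : padic_int p_pr -> E :=
  in_alg E \o (@tofrac (padic_int p_pr) : _ -> padic p_pr).

HB.instance Definition _ := GRing.RMorphism.on padic_int_to.

Definition integral_pred : {pred E} := fun x => `[< integralOver padic_int_to x >].

Lemma integral_pred_subring : subring_closed integral_pred.
Proof.
split=> [|x y /asboolP hx /asboolP hy|x y /asboolP hx /asboolP hy]; apply/asboolP.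
- exact: integral1.
- exact: integral_sub.
- exact: integral_mul.
Qed.

HB.instance Definition _ :=
  GRing.isSubringClosed.Build E integral_pred integral_pred_subring.

Record integers := Integers { integers_val :> E; _ : integers_val \in integral_pred }.

HB.instance Definition _ := [isSub for integers_val].
HB.instance Definition _ := [Choice of integers by <:].
HB.instance Definition _ := [SubChoice_isSubComNzRing of integers by <:].
HB.instance Definition _ := GRing.RMorphism.copy integers_val (\val : integers -> E).

End RingOfIntegers.

Section CommutativeAlgebra.
Variable A : comNzRingType.

Definition invertible (x : A) := exists y, y * x = 1.

Definition principal (x : A) : set A := [set z | exists y, z = y * x].

Definition ideal (I : set A) :=
  [/\ I 0, forall x y, I x -> I y -> I (x + y) & forall a x, I x -> I (a * x)].

Definition maximal_ideal (I : set A) :=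
  [/\ ideal I, ~ I 1 & forall J, ideal J -> I `<=` J -> ~ J 1 -> J = I].

Definition local_ring := exists! m : set A, maximal_ideal m.

(* In a local ring the maximal ideal is the set of non-invertible elements. *)
Definition uniformizer (w : A) := [set x | ~ invertible x] = principal w.

Definition reduced := forall (x : A) n, x ^+ n = 0 -> x = 0.

Definition finitely_generated (U : lmodType A) :=
  exists n (g : 'I_n -> U), forall u, exists c : 'I_n -> A,
    u = \sum_(i < n) c i *: g i.

Definition torsion_free (w : A) (U : lmodType A) := forall u : U, w *: u = 0 -> u = 0.

Definition bilinear_map (U V W : lmodType A) (b : U -> V -> W) :=
  (forall u, linear (b u)) /\ (forall v, linear (b^~ v)).

(* (W, b) is the tensor product of U and V over A. *)
Definition is_tensor (U V W : lmodType A) (b : U -> V -> W) :=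
  bilinear_map b /\
  forall (X : lmodType A) (c : U -> V -> X), bilinear_map c ->
    exists h : {linear W -> X}, (forall u v, h (b u v) = c u v) /\
      forall h' : {linear W -> X}, (forall u v, h' (b u v) = c u v) -> h' =1 h.

End CommutativeAlgebra.

(* Restriction of scalars along f. *)
Definition restrict (A B : nzRingType) (f : {rmorphism A -> B})
  (U : lmodType B) : Type := U.

Section Restriction.
Variables (A B : nzRingType) (f : {rmorphism A -> B}).

Variable U : lmodType B.
Local Notation restrict := (restrict f).

HB.instance Definition _ := GRing.Zmodule.copy (restrict U) U.

Definition restrict_scale (a : A) (u : restrict U) : restrict U := f a *: (u : U).

Lemma restrict_scaleA a b u :
  restrict_scale a (restrict_scale b u) = restrict_scale (a * b) u.
Proof. by rewrite /restrict_scale scalerA rmorphM. Qed.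
Lemma restrict_scale1 : left_id 1 restrict_scale.
Proof. by move=> u; rewrite /restrict_scale rmorph1 scale1r. Qed.
Lemma restrict_scaleDr : right_distributive restrict_scale +%R.
Proof. by move=> a u v; rewrite /restrict_scale scalerDr. Qed.
Lemma restrict_scaleDl u : {morph restrict_scale^~ u : a b / a + b}.
Proof. by move=> a b; rewrite /restrict_scale rmorphD scalerDl. Qed.

HB.instance Definition _ := GRing.Zmodule_isLmodule.Build A (restrict U)
  restrict_scaleA restrict_scale1 restrict_scaleDr restrict_scaleDl.

End Restriction.

Section Hom.
Variables (A : comNzRingType) (U V : lmodType A).

Definition linear_pred : {pred U -> V} := fun f => `[< linear f >].

Lemma linear_pred_submod : submod_closed linear_pred.
Proof.
split=> [|a f g /asboolP hf /asboolP hg]; apply/asboolP => b u v.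
  by rewrite scaler0 addr0.
rewrite /= !fctE hf hg !scalerDr !scalerA addrACA.
by rewrite [a * b]mulrC.
Qed.

HB.instance Definition _ :=
  GRing.isSubmodClosed.Build A (U -> V) linear_pred linear_pred_submod.

Record hom := Hom { hom_fun :> U -> V; _ : hom_fun \in linear_pred }.

HB.instance Definition _ := [isSub for hom_fun].
HB.instance Definition _ := [Choice of hom by <:].
HB.instance Definition _ := [SubChoice_isSubLmodule of hom by <:].

Lemma hom_linear (f : hom) : linear f.
Proof. by case: f => f /= /asboolP. Qed.

HB.instance Definition _ (f : hom) :=
  GRing.isLinear.Build A U V _ (hom_fun f) (hom_linear f).

End Hom.

Section Homothety.
Variables (A : comNzRingType) (U : lmodType A).

Lemma homothety_subproof (a : A) : (fun u : U => a *: u) \in @linear_pred A U U.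
Proof. by apply/asboolP => b u v; rewrite scalerDr !scalerA mulrC. Qed.

(* The natural map A -> End_A(U). *)
Definition homothety (a : A) : hom U U := Hom (homothety_subproof a).

End Homothety.

Section Cokernel.
Variables (U V : zmodType) (f : {additive U -> V}).

Definition image_pred : {pred V} := fun v => `[< exists u, f u = v >].

Lemma image_pred_zmod : zmod_closed image_pred.
Proof.
split=> [|v w /asboolP[x <-] /asboolP[y <-]]; apply/asboolP.
  by exists 0; rewrite raddf0.
by exists (x - y); rewrite raddfB.
Qed.

HB.instance Definition _ := GRing.isZmodClosed.Build V image_pred image_pred_zmod.

Definition coker := {ideal_quot image_pred}.
HB.instance Definition _ := GRing.Zmodule.on coker.

End Cokernel.

(* The order of a finite type; it is 0 when T is infinite. *)
Definition order_of (T : choiceType) : nat := #|` fset_set [set: T]|.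

Section Dual.
Variables (O : comNzRingType) (R : comAlgType O).

(* An R-module seen as an O-module. *)
Definition res (M : lmodType R) : lmodType O := restrict (in_alg R) M.

Definition dual_hom (M : lmodType R) : Type := hom (res M) O^o.

Section DualModule.
Variable M : lmodType R.
HB.instance Definition _ := GRing.Zmodule.on (dual_hom M).

Lemma dual_scale_subproof (r : R) (f : dual_hom M) :
  (fun m : M => f (r *: m)) \in @linear_pred O (res M) O^o.
Proof.
apply/asboolP => a u v; rewrite -hom_linear; congr (hom_fun f _).
change (r *: ((a%:A : R) *: (u : M) + (v : M)) =
        (a%:A : R) *: (r *: (u : M)) + r *: (v : M)).
by rewrite scalerDr !scalerA mulrC.
Qed.
Definition dual_scale r f : dual_hom M := Hom (dual_scale_subproof r f).

Lemma dualP (f g : dual_hom M) : (forall m, f m = g m) -> f = g.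
Proof. by move=> e; apply/val_inj/funext. Qed.

Lemma dual_scaleA a b f : dual_scale a (dual_scale b f) = dual_scale (a * b) f.
Proof. by apply: dualP => m /=; rewrite scalerA mulrC. Qed.
Lemma dual_scale1 : left_id 1 dual_scale.
Proof. by move=> f; apply: dualP => m /=; rewrite scale1r. Qed.
Lemma dual_scaleDr : right_distributive dual_scale +%R.
Proof. by move=> a f g; apply: dualP. Qed.
Lemma dual_scaleDl f : {morph dual_scale^~ f : a b / a + b}.
Proof. by move=> a b; apply: dualP => m /=; rewrite scalerDl raddfD. Qed.

HB.instance Definition _ := GRing.Zmodule_isLmodule.Build R (dual_hom M)
  dual_scaleA dual_scale1 dual_scaleDr dual_scaleDl.

End DualModule.

(* M^* = Hom_O(M, O) as an R-module. *)
Definition dual (M : lmodType R) : lmodType R := dual_hom M.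

Section Bidual.
Variable M : lmodType R.

Lemma bidual_subproof (m : M) :
  (fun f : dual_hom M => f m) \in @linear_pred O (res (dual M)) O^o.
Proof.
apply/asboolP => a f g /=; congr (_ + _).
exact: (linearZ_LR (f : hom (res M) O^o) a (m : res M)).
Qed.
Definition bidual (m : M) : dual (dual M) := Hom (bidual_subproof m).

Lemma bidual_linear : linear bidual.
Proof. by move=> r m n; apply: dualP => f /=; rewrite raddfD. Qed.
HB.instance Definition _ :=
  GRing.isLinear.Build R M (dual (dual M)) _ bidual bidual_linear.

Definition reflexive_module := finitely_generated M /\ bijective bidual.

End Bidual.

Section DualMap.
Variables (M N : lmodType R) (h : {linear M -> N}).

Lemma dual_map_subproof (f : dual_hom N) :
  (fun m : M => f (h m)) \in @linear_pred O (res M) O^o.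
Proof.
apply/asboolP => a u v; rewrite -hom_linear; congr (hom_fun f _).
by rewrite linearP.
Qed.
Definition dual_map (f : dual N) : dual M := Hom (dual_map_subproof f).

Lemma dual_map_linear : linear dual_map.
Proof.
move=> r f g; apply: dualP => m.
change ((f : dual_hom N) (r *: h m) + (g : dual_hom N) (h m) =
        (f : dual_hom N) (h (r *: m)) + (g : dual_hom N) (h m)).
by rewrite linearZ.
Qed.
HB.instance Definition _ :=
  GRing.isLinear.Build R (dual N) (dual M) _ dual_map dual_map_linear.

End DualMap.

End Dual.

Section Augmentation.
Variables (O : comNzRingType) (R : comAlgType O) (lambda : {lrmorphism R -> O^o}).

Section Torsion.
Variable M : lmodType R.

Definition ker_torsion_pred : {pred M} :=
  fun m => `[< forall r, lambda r = 0 -> r *: m = 0 >].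

Lemma ker_torsion_submod : submod_closed ker_torsion_pred.
Proof.
split=> [|a u v /asboolP hu /asboolP hv]; apply/asboolP => r hr.
  by rewrite scaler0.
by rewrite scalerDr scalerA mulrC -scalerA hu // hv // scaler0 addr0.
Qed.

HB.instance Definition _ :=
  GRing.isSubmodClosed.Build R M ker_torsion_pred ker_torsion_submod.

(* M[ker lambda] *)
Record ker_torsion :=
  KerTorsion { ker_torsion_val :> M; _ : ker_torsion_val \in ker_torsion_pred }.

HB.instance Definition _ := [isSub for ker_torsion_val].
HB.instance Definition _ := [Choice of ker_torsion by <:].
HB.instance Definition _ := [SubChoice_isSubLmodule of ker_torsion by <:].
HB.instance Definition _ :=
  GRing.Linear.copy ker_torsion_val (\val : ker_torsion -> M).

End Torsion.

Definition congruence_map (M : lmodType R) :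
    ker_torsion M -> dual (ker_torsion (dual M)) :=
  dual_map (@ker_torsion_val (dual M)) \o @bidual O R M \o @ker_torsion_val M.

HB.instance Definition _ (M : lmodType R) := GRing.Linear.on (@congruence_map M).

Definition congruence_module (M : lmodType R) := coker (@congruence_map M).
HB.instance Definition _ (M : lmodType R) := GRing.Zmodule.on (congruence_module M).

Definition aug_ker_pred : {pred R} := fun r => lambda r == 0.

Lemma aug_ker_zmod : zmod_closed aug_ker_pred.
Proof.
split=> [|x y]; rewrite !unfold_in; first by rewrite raddf0.
by move=> /eqP hx /eqP hy; rewrite raddfB /= hx hy subrr.
Qed.
HB.instance Definition _ := GRing.isZmodClosed.Build R aug_ker_pred aug_ker_zmod.

Record aug_ker := AugKer { aug_ker_val :> R; _ : aug_ker_val \in aug_ker_pred }.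

HB.instance Definition _ := [isSub for aug_ker_val].
HB.instance Definition _ := [Choice of aug_ker by <:].
HB.instance Definition _ := [SubChoice_isSubZmodule of aug_ker by <:].

(* (ker lambda)^2, inside ker lambda *)
Definition aug_ker_sq : {pred aug_ker} := fun x =>
  `[< exists n (y z : 'I_n -> aug_ker),
        (x : R) = \sum_(i < n) (y i : R) * (z i : R) >].

Lemma aug_ker_sq_zmod : zmod_closed aug_ker_sq.
Proof.
split=> [|x x' /asboolP[n [y [z e]]] /asboolP[n' [y' [z' e']]]]; apply/asboolP.
  by exists 0%N, (fun=> 0), (fun=> 0); rewrite big_ord0.
exists (n + n')%N.
exists (fun i => match fintype.split i with inl j => y j | inr j => - y' j end).
exists (fun i => match fintype.split i with inl j => z j | inr j => z' j end).
rewrite big_split_ord /= e e' -sumrN; congr (_ + _); apply: eq_bigr => i _.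
  by rewrite (unsplitK (inl _)).
by rewrite (unsplitK (inr _)) /= mulNr.
Qed.
HB.instance Definition _ :=
  GRing.isZmodClosed.Build aug_ker aug_ker_sq aug_ker_sq_zmod.

Definition cotangent := {ideal_quot aug_ker_sq}.
HB.instance Definition _ := GRing.Zmodule.on cotangent.

End Augmentation.

Definition quo_principal (A : comNzRingType) (a : A) : Type := coker (a \*o @idfun A).
HB.instance Definition _ (A : comNzRingType) (a : A) := GRing.Zmodule.on (quo_principal a).

Section WilesDefect.
Variables (p : nat) (p_pr : prime p) (E : fieldExtType (padic p_pr)).
Local Notation O := (integers E).
Variables (R : comAlgType O) (lambda : {lrmorphism R -> O^o}).

Definition has_lambda_rank (M : lmodType R) (d : nat) :=
  exists (V : vectType E)
    (b : res (ker_torsion lambda M) -> restrict (@integers_val p p_pr E) E^o ->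
         restrict (@integers_val p p_pr E) V),
    [/\ is_tensor b,
        forall m (x y : E), b m (x * y) = x *: (b m y : V) &
        \dim {:V} = d].

Definition lambda_rank (M : lmodType R) : nat := xget 0%N (has_lambda_rank M).

Definition wiles_defect (RR : realType) (M : lmodType R) : RR :=
  let d := (lambda_rank M)%:R in
  (d * ln (order_of (cotangent lambda))%:R
     - ln (order_of (congruence_module lambda M))%:R) /
  (d * ln (order_of (quo_principal (p%:R : O)))%:R).

(* All the quantities in the formula for wiles_defect are meaningful. *)
Definition defect_defined (M : lmodType R) :=
  [/\ (0 < lambda_rank M)%N,
      finite_set [set: cotangent lambda],
      finite_set [set: congruence_module lambda M] &
      finite_set [set: quo_principal (p%:R : O)]].

End WilesDefect.

(* Main.v *)
(* If s is an element of R killed by ker lambda, then R acts on s through lambda,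
   and s M lies in M[ker lambda]. Rank one makes M[ker lambda] = O m0 and
   M^*[ker lambda] = O f0, with f0 onto O, so Psi(M) is O/f0(m0); likewise Psi(R) is
   O/lambda(t), where R[ker lambda] = O t. If f0(m1) = 1 and t m1 = c m0, applying
   f0 gives lambda(t) = c f0(m0), whence the inequality. If R = End_R(M), the
   endomorphism m |-> f0(m) m0 is an element of R[ker lambda] on which lambda
   takes the value f0(m0), so the two ideals agree.
   The finiteness of O/a comes from O/p: elements of O independent mod p are
   linearly independent over Q_p, so there are at most [E : Q_p] of them. *)

Require Import Defs.
From HB Require Import structures.
From mathcomp Require Import all_boot all_order all_algebra all_field.
From mathcomp Require Import finmap boolp classical_sets functions cardinality.
From mathcomp Require Import reals exp.

Set Implicit Arguments.
Unset Strict Implicit.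
Unset Printing Implicit Defensive.
Import Order.TTheory GRing.Theory Num.Theory.
Local Open Scope ring_scope.

(** * The p-adic integers *)

Section PadicIntegersArithmetic.
Variables (p : nat) (p_pr : prime p).
Implicit Types (x y : padic_int p_pr) (n : nat).

Local Notation q n := (Posz (p ^ n)%N).

Lemma padic_resD x y n : (x + y) n = ((x n + y n) %% q n)%Z.
Proof. by []. Qed.

Lemma padic_resM x y n : (x * y) n = ((x n * y n) %% q n)%Z.
Proof. by []. Qed.

Lemma padic_resN x n : (- x) n = ((- x n) %% q n)%Z.
Proof. by []. Qed.

Lemma padic_res_nat k n : (k%:R : padic_int p_pr) n = (k%:Z %% q n)%Z.
Proof.
elim: k => [//|k IHk].
by rewrite -natr1 padic_resD IHk -addn1 PoszD modzDm.
Qed.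

Lemma padic_res0 x : x 0%N = 0.
Proof. by rewrite -padic_res_mod expn0 modz1. Qed.

Lemma pexpz_gt0 n : 0 < q n.
Proof. by rewrite ltz_nat expn_gt0 prime_gt0. Qed.

Lemma pexpz_neq0 n : q n != 0.
Proof. by rewrite gt_eqF // pexpz_gt0. Qed.

(** Coherence of the residues of x / p^n: multiples of p^n congruent mod p^(n+m) have quotients
    congruent mod p^m. *)
Lemma padic_divp_subproof x n : x n = 0 ->
  forall m, ((x (n + m.+1)%N %/ q n)%Z = (x (n + m)%N %/ q n)%Z %[mod q m])%Z.
Proof.
move=> xn0 m.
have dvdx k : (q n %| x (n + k)%N)%Z.
  by apply/dvdz_mod0P; rewrite (padic_res_le x (leq_addr k n)).
apply/eqP; rewrite eqz_mod_dvd -(@dvdz_mul2r (q n)) ?pexpz_neq0 //.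
rewrite mulrBl !divzK //.
have -> : q m * q n = q (n + m)%N by rewrite -PoszM -expnD addnC.
by rewrite -eqz_mod_dvd addnS padic_resS padic_res_mod.
Qed.

Lemma padic_res_expM x n : ((p ^ n)%:R * x) n = 0.
Proof. by rewrite padic_resM padic_res_nat modzz mul0r mod0z. Qed.

Lemma padic_divp x n : x n = 0 -> exists y, x = (p ^ n)%:R * y.
Proof.
move=> xn0; exists (padic_mk p_pr (padic_divp_subproof xn0)).
apply: padic_intP => m; rewrite padic_resM padic_res_nat /= modzMml modzMmr.
rewrite mulrC divzK ?(padic_res_le x (leq_addl n m)) //.
by apply/dvdz_mod0P; rewrite (padic_res_le x (leq_addr m n)).
Qed.

Lemma padic_pexp_neq0 n : (p ^ n)%:R != 0 :> padic_int p_pr.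
Proof.
apply/eqP => /(congr1 (fun x : padic_int p_pr => x n.+1)).
rewrite padic_res_nat [RHS]mod0z modz_small ?pexpz_neq0 //.
  by move/eqP; rewrite (negPf (pexpz_neq0 n)).
by rewrite (ltW (pexpz_gt0 n)) /= ltz_nat ltn_exp2l ?prime_gt1.
Qed.

(** Each [x n] is prime to [p ^ n], so Bezout inverts it; coherence holds because an inverse mod p^n
    is unique. *)
Lemma padic_inv_subproof x : x 1%N != 0 ->
  exists2 f : nat -> int, (forall n, (f n.+1 = f n %[mod q n])%Z) &
                          forall n, (f n * x n = 1 %[mod q n])%Z.
Proof.
move=> x1.
have cop n : coprimez (x n) (q n).
  case: n => [|n]; first by rewrite expn0 coprimezE coprimen1.
  rewrite coprimez_sym coprimezE absz_nat coprime_pexpl // prime_coprime //.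
  apply: contra x1 => px; rewrite -(padic_res_le x (ltn0Sn n)) expn1.
  exact/eqP/dvdz_mod0P.
have /choice[f fP] n : exists u, (u * x n = 1 %[mod q n])%Z.
  have [u [v]] := Bezoutz (x n) (q n).
  by rewrite (eqP (cop n)) => uvE; exists u; rewrite -uvE addrC modzMDl.
exists f => // n.
have fS : (f n.+1 * x n = 1 %[mod q n])%Z.
  have dqS : (q n %| q n.+1)%Z by rewrite dvdzE /= dvdn_exp2l.
  by rewrite -(padic_resS x n) modzMmr -(modz_dvd _ dqS) fP modz_dvd.
rewrite -[f n.+1 in LHS]mulr1 -modzMmr -(fP n) modzMmr.
by rewrite mulrCA -modzMmr fS modzMmr mulr1.
Qed.

Lemma padic_inv_ex x : x 1%N != 0 -> exists y, y * x = 1.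
Proof.
case/padic_inv_subproof => f fS fP; exists (padic_mk p_pr fS).
by apply: padic_intP => n; rewrite padic_resM /= modzMml fP.
Qed.

Lemma padic_primitive k (x : 'I_k -> padic_int p_pr) i : x i != 0 ->
  exists n (y : 'I_k -> padic_int p_pr),
    (forall j, x j = (p ^ n)%:R * y j) /\ exists j, y j 1%N != 0.
Proof.
move=> xi0; have exP : exists n, [exists j, x j n != 0].
  by have [n xin] := padic_neq0 xi0; exists n; apply/existsP; exists i.
(* Level 0 is excluded, as residues mod 1 vanish. A first nonzero residue at level n + 1 means that
   p^n divides every entry. *)
have [[|n] /existsP[j xjn] min_n] := ex_minnP exP.
  by rewrite padic_res0 eqxx in xjn.
have /choice[y yE] l : exists yl, x l = (p ^ n)%:R * yl.
  apply: padic_divp; apply/eqP/negPn/negP => xln.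
  by have /min_n : [exists j, x j n != 0]; [apply/existsP; exists l | rewrite ltnn].
exists n, y; split=> //; exists j; apply: contra xjn => /eqP/padic_divp[z zE].
by rewrite yE zE mulrA -natrM -expnD addn1 padic_res_expM.
Qed.

Lemma padic_exp_unit x : x != 0 -> exists n y z, x = (p ^ n)%:R * y /\ z * y = 1.
Proof.
move=> x0; have [n [y [yE [j]]]] := @padic_primitive 1 (fun=> x) ord0 x0.
by case/padic_inv_ex => z zy; exists n, (y j), z; split.
Qed.

(** The digit is a natural number, the form of coefficient that [independent_modp] takes. *)
Lemma padic_digit x : exists y, x = (absz (x 1%N))%:R + p%:R * y.
Proof.
have [|y yE] := @padic_divp (x - (absz (x 1%N))%:R) 1.
  rewrite padic_resD padic_resN padic_res_nat gez0_abs; last first.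
    by rewrite -padic_res_mod modz_ge0 ?pexpz_neq0.
  by rewrite padic_res_mod modzDmr subrr mod0z.
by exists y; rewrite -[X in X%:R * y]expn1 -yE addrC subrK.
Qed.

Lemma padic_frac (a : padic p_pr) :
  exists x y : padic_int p_pr, y != 0 /\ tofrac y * a = tofrac x.
Proof.
elim/quotW: a => r; exists r.1, r.2; split; first exact: denom_ratioP.
unlock tofrac; rewrite -[LHS]FracField.pi_mul.
apply/eqP; rewrite FracField.equivf_def /mulf.
by rewrite !numden_Ratio ?mulf_neq0 ?oner_eq0 ?denom_ratioP // !mul1r mulr1 mulrC.
Qed.

Lemma padic_common_denominator (I : finType) (a : I -> padic p_pr) :
  exists2 d : padic_int p_pr, d != 0 &
    exists x : I -> padic_int p_pr, forall i, tofrac d * a i = tofrac (x i).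
Proof.
have /choice[x /choice[d dE]] i := padic_frac (a i).
exists (\prod_i d i); first by apply/prodf_neq0 => i _; have [] := dE i.
exists (fun i => (\prod_(j | j != i) d j) * x i) => i.
rewrite (bigD1 i) //= !rmorphM /= mulrAC (dE i).2.
by rewrite mulrC.
Qed.

End PadicIntegersArithmetic.

(** * The ring of integers *)

(* Determinant trick: a root of the characteristic polynomial, up to the
   annihilator of the module spanned by the [g j]. *)
Lemma char_poly_annihilates (A B : comNzRingType) (f : {rmorphism A -> B}) n
    (z : 'M[A]_n) (g : 'I_n -> B) (x : B) :
  (forall i, x * g i = \sum_j f (z i j) * g j) ->
  forall j, (map_poly f (char_poly z)).[x] * g j = 0.
Proof.
move=> xg j; pose G := \col_i g i.
pose N := map_mx (horner_eval x) (char_poly_mx (map_mx f z)).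
have NG : N *m G = 0.
  apply/matrixP => i k; rewrite !mxE.
  transitivity (\sum_l ((x *+ (i == l)) * g l - f (z i l) * g l)).
    apply: eq_bigr => l _; rewrite !mxE -mulrBl; congr (_ * _).
    by rewrite /horner_eval !hornerE hornerMn hornerX.
  rewrite sumrB -xg (bigD1 i) //= eqxx mulr1n big1 ?addr0 ?subrr // => l il.
  by rewrite eq_sym (negPf il) mulr0n mul0r.
have detN : \det N = (map_poly f (char_poly z)).[x].
  by rewrite det_map_mx map_char_poly.
have /matrixP/(_ j 0) : (\det N)%:M *m G = 0 by rewrite -mul_adj_mx -mulmxA NG mulmx0.
by rewrite mul_scalar_mx !mxE detN.
Qed.

(** The value of the polynomial at [x] kills each [g i], hence also 1. *)
Lemma char_poly_root (A B : comNzRingType) (f : {rmorphism A -> B}) n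
    (z : 'M[A]_n) (g c : 'I_n -> B) (x : B) :
  (forall i, x * g i = \sum_j f (z i j) * g j) -> 1 = \sum_i c i * g i ->
  root (map_poly f (char_poly z)) x.
Proof.
move=> xg gen1; apply/eqP; rewrite -[LHS]mulr1 gen1 mulr_sumr big1 // => j _.
by rewrite mulrCA (char_poly_annihilates xg) mulr0.
Qed.

(** Dropping a power of X from an integral equation gives it the nonzero constant term on which its
    uses rest. *)
Lemma poly_split_X (A : nzRingType) (P : {poly A}) : P != 0 ->
  exists m (Q : {poly A}), Q`_0 != 0 /\ P = Q * 'X ^+ m.
Proof.
elim/poly_ind: P => [/eqP//|P c IHP Pc0].
have [c0|cN0] := eqVneq c 0; last first.
  exists 0%N, (P * 'X + c%:P); rewrite expr0 mulr1; split=> //.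
  by rewrite coefD coefMX coefC add0r.
have [|m [Q [Q0 ->]]] := IHP.
  by apply: contraNneq Pc0 => ->; rewrite c0 mul0r addr0.
by exists m.+1, Q; rewrite c0 addr0 exprSr mulrA.
Qed.

Lemma horner_coef0_mod (A : comNzRingType) (P : {poly A}) a :
  exists c, P.[a] = c * a + P`_0.
Proof.
elim/poly_ind: P => [|P c _]; first by exists 0; rewrite horner0 mul0r coef0 addr0.
by exists P.[a]; rewrite hornerMXaddC coefD coefMX coefC add0r.
Qed.

Lemma fieldExt_finite (F : fieldType) (L : fieldExtType F) :
  exists n (g : 'I_n -> L), forall y, exists c : 'I_n -> F,
    y = \sum_i in_alg L (c i) * g i.
Proof.
exists (\dim {:L}), (fun i => (vbasis {:L})`_i) => y.
exists (fun i => coord (vbasis {:L}) i y).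
rewrite {1}(coord_vbasis (memvf y)); apply: eq_bigr => i _.
by rewrite mulr_algl.
Qed.

Section RingOfIntegersTheory.
Variables (p : nat) (p_pr : prime p) (E : fieldExtType (padic p_pr)).
Local Notation O := (integers E).
Local Notation Zp := (padic_int p_pr).
Local Notation iota := (padic_int_to E).

Lemma padic_int_to_integral (x : Zp) : iota x \in integral_pred (E := E).
Proof. by apply/asboolP/integral_id. Qed.

Lemma padic_int_to_mul (d z : Zp) (c : padic p_pr) :
  tofrac d * c = tofrac z -> iota d * in_alg E c = iota z.
Proof. by move=> dc; rewrite [RHS](congr1 (in_alg E) (esym dc)) [RHS]rmorphM. Qed.

Definition padic_integer (x : Zp) : O := Integers (padic_int_to_integral x).

Lemma padic_integer_is_zmod_morphism : zmod_morphism padic_integer.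
Proof. by move=> x y; apply: val_inj; rewrite /= rmorphB. Qed.
HB.instance Definition _ := GRing.isZmodMorphism.Build Zp O padic_integer
  padic_integer_is_zmod_morphism.

Lemma padic_integer_is_monoid_morphism : monoid_morphism padic_integer.
Proof.
by split=> [|x y]; apply: val_inj; rewrite /= ?rmorph1 ?rmorphM.
Qed.
HB.instance Definition _ := GRing.isMonoidMorphism.Build Zp O padic_integer
  padic_integer_is_monoid_morphism.

Lemma padic_int_to_inj : injective iota.
Proof.
by move=> x y /fmorph_inj/eqP; rewrite tofrac_eq => /eqP.
Qed.

Lemma padic_integer_eq0 (x : Zp) : (padic_integer x == 0) = (x == 0).
Proof.
apply/eqP/eqP => [|->]; last exact: rmorph0.
move/(congr1 (@integers_val _ _ E)); rewrite rmorph0 /= -(rmorph0 iota).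
exact: padic_int_to_inj.
Qed.

Lemma integers_mul_eq0 (a b : O) : a * b = 0 -> a = 0 \/ b = 0.
Proof.
move/(congr1 (@integers_val _ _ E)); rewrite rmorphM rmorph0 => /eqP.
by rewrite mulf_eq0 => /orP[] /eqP; [left | right]; apply: val_inj.
Qed.

(** Multiplication by [x] has a matrix over Q_p on a finite generating family. Scaled by a common
    denominator d it has entries in Z_p, and its characteristic polynomial shows d x integral. *)
Lemma integers_frac (x : E) : exists a b : O, a <> 0 /\ (a : E) * x = (b : E).
Proof.
have [n [g gP]] := fieldExt_finite E.
have /choice[a aE] i := gP (x * g i).
have [d d0 [z zE]] := padic_common_denominator (fun ij : 'I_n * 'I_n => a ij.1 ij.2).
have dxg (i : 'I_n) : iota d * x * g i = \sum_j iota (z (i, j)) * g j.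
  rewrite -mulrA aE mulr_sumr; apply: eq_bigr => j _.
  by rewrite mulrA (padic_int_to_mul (zE (i, j))).
have d_neq0 : padic_integer d <> 0 by apply/eqP; rewrite padic_integer_eq0.
have dx_int : iota d * x \in integral_pred (E := E).
  apply/asboolP; exists (char_poly (\matrix_(i, j) z (i, j))).
    exact: char_poly_monic.
  have [c oneE] := gP 1; apply: char_poly_root oneE => i; rewrite dxg.
  by apply: eq_bigr => j _; rewrite mxE.
by exists (padic_integer d), (Integers dx_int).
Qed.

(** In an integral equation of [a] with nonzero constant term, that term is a multiple of [a]; in
    Z_p it is a power of p times a unit. *)
Lemma integers_dvd_pexp (a : O) : a <> 0 -> exists n b, b * a = (p ^ n)%:R.
Proof.
move=> a0; have a_neq0 : (a : E) != 0.
  by apply: contra_not_neq a0 => a0; apply: val_inj.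
have /asboolP[P Pmonic] : (a : E) \in integral_pred (E := E) by case: (a).
have [m [Q [Q0 ->]]] := poly_split_X (monic_neq0 Pmonic).
rewrite rmorphM rmorphXn /= map_polyX rootM => /orP[|]; last first.
  by case: m => [|m]; rewrite ?root1 // /root hornerXn expf_eq0 (negPf a_neq0) andbF.
move/eqP => Qa; pose QO := map_poly padic_integer Q.
have QOa : QO.[a] = 0.
  apply: val_inj; rewrite [LHS](esym (horner_map (@integers_val _ _ E) QO a)).
  by rewrite -map_poly_comp [LHS]Qa.
have [c cE] : exists c, QO.[a] = c * a + padic_integer Q`_0.
  by have [c ->] := horner_coef0_mod QO a; exists c; rewrite coef_map.
have [n [y [u [Q0E uy]]]] := padic_exp_unit Q0.
exists n, (- (padic_integer u * c)).
rewrite mulNr -mulrA; have -> : c * a = - padic_integer Q`_0.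
  by apply/eqP; rewrite -addr_eq0 -cE QOa.
rewrite mulrN opprK -rmorphM Q0E mulrCA uy mulr1.
by rewrite rmorph_nat.
Qed.

End RingOfIntegersTheory.

(** * Finiteness of the residue rings of O *)

Lemma fraction_numer_neq0 (R : idomainType) (d z : R) (a : {fraction R}) :
  d != 0 -> a != 0 -> tofrac d * a = tofrac z -> z != 0.
Proof.
move=> d0 a0 daE; rewrite -tofrac_eq0 -daE mulf_neq0 // tofrac_eq0 //.
Qed.

(** Finiteness of A/(a) without quotient types: finitely many representatives, repetitions
    allowed. *)
Definition finite_residues (A : comNzRingType) (a : A) :=
  exists (I : finType) (r : I -> A), forall x, exists i y, x = r i + y * a.

Lemma finite_residuesM (A : comNzRingType) (a b : A) :
  finite_residues a -> finite_residues b -> finite_residues (a * b).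
Proof.
case=> I [r rP] [J [s sP]]; exists (I * J)%type, (fun ij => r ij.1 + s ij.2 * a) => x.
have [i [y ->]] := rP x; have [j [z ->]] := sP y; exists (i, j), z => /=.
by rewrite mulrDl addrA -mulrA [b * a]mulrC.
Qed.

Lemma finite_residues1 (A : comNzRingType) : finite_residues (1 : A).
Proof. by exists unit, (fun=> 0) => x; exists tt, x; rewrite mulr1 add0r. Qed.

Lemma finite_residues_dvd (A : comNzRingType) (a b : A) :
  finite_residues (b * a) -> finite_residues a.
Proof.
case=> I [r rP]; exists I, r => x; have [i [y ->]] := rP x.
by exists i, (y * b); rewrite mulrA.
Qed.

Lemma fieldExt_dependent (F : fieldType) (L : fieldExtType F) :
  exists d, forall k (x : 'I_k -> L), (d < k)%N -> exists2 a : 'I_k -> F,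
    exists i, a i != 0 & \sum_i in_alg L (a i) * x i = 0.
Proof.
exists (\dim {:L}) => k x dk.
have : ~~ free [tuple x i | i < k].
  apply/negP => /eqP xfree; move: dk.
  by rewrite ltnNge -[k in (k <= _)%N](size_tuple [tuple x i | i < k]) -xfree
    dimvS ?subvf.
move/freeP; rewrite -existsNE => -[a /not_implyP[ax0 /existsNP[i ai]]].
exists a; first by exists i; apply/eqP.
rewrite -[RHS]ax0; apply: eq_bigr => j _.
by rewrite mulr_algl -tnth_nth tnth_mktuple.
Qed.

Section ResidueRing.
Variables (p : nat) (p_pr : prime p) (E : fieldExtType (padic p_pr)).
Local Notation O := (integers E).
Local Notation iota := (padic_int_to E).

(** Linear independence over F_p of the images in O/p, natural numbers standing for the
    coefficients. *)
Definition independent_modp k (x : 'I_k -> O) := forall c : 'I_k -> nat,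
  (exists y, \sum_i (c i)%:R * x i = y * p%:R) -> forall i, (p %| c i)%N.

(** Too many elements satisfy a relation over Q_p; made primitive over Z_p, it reduces to a
    nontrivial relation mod p. *)
Lemma independent_modp_bound :
  exists d, forall k (x : 'I_k -> O), independent_modp x -> (k <= d)%N.
Proof.
have [d dE] := fieldExt_dependent E; exists d => k x xind.
rewrite leqNgt; apply/negP => /(dE _ (fun i => x i : E))[a [i ai0] ax0].
have [e e0 [z zE]] := padic_common_denominator a.
have zi0 : z i != 0. by exact: fraction_numer_neq0 (zE i).
have zx0 : \sum_l padic_integer E (z l) * x l = 0.
  apply: val_inj; rewrite [RHS]rmorph0 -[RHS](mulr0 (iota e)) -[in RHS]ax0.
  rewrite [LHS]rmorph_sum mulr_sumr; apply: eq_bigr => l _.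
  by rewrite [LHS]rmorphM mulrA (padic_int_to_mul E (zE l)).
have [n [y [yE [j yj]]]] := padic_primitive zi0.
have yx0 : \sum_l padic_integer E (y l) * x l = 0.
  have pyx0 : (p ^ n)%:R * \sum_l padic_integer E (y l) * x l = 0.
    rewrite -[RHS]zx0 mulr_sumr; apply: eq_bigr => l _.
    by rewrite yE rmorphM rmorph_nat mulrA.
  case/integers_mul_eq0: pyx0 => // /eqP; rewrite -(rmorph_nat (padic_integer E)).
  by rewrite padic_integer_eq0 (negPf (padic_pexp_neq0 p_pr n)).
have /choice[t tE] l := padic_digit (y l).
have /xind/(_ j) : exists u, \sum_l (absz (y l 1%N))%:R * x l = u * p%:R.
  exists (- \sum_l padic_integer E (t l) * x l).
  apply/eqP; rewrite mulNr -addr_eq0 mulr_suml -big_split /=.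
  rewrite -[X in _ == X]yx0; apply/eqP/eq_bigr => l _; rewrite [in RHS]tE.
  rewrite rmorphD rmorphM !rmorph_nat mulrDl; congr (_ + _).
  by rewrite mulrC mulrA.
move=> pyj; case/negP: yj; rewrite -padic_res_mod expn1.
by apply/eqP/dvdz_mod0P.
Qed.

(** A maximal family independent mod p spans O/p over F_p, so its combinations with coefficients
    below p represent every class. *)
Lemma finite_residues_p : finite_residues (p%:R : O).
Proof.
have [d dP] := independent_modp_bound.
pose P k := `[< exists x : 'I_k -> O, independent_modp x >].
have P0 : exists k, P k by exists 0%N; apply/asboolP; exists (fun=> 0) => c _ [].
have Pd k : P k -> (k <= d)%N by move=> /asboolP[x /dP].
have [k /asboolP[x xind] kmax] := ex_maxnP P0 Pd.
exists {ffun 'I_k -> 'I_p}, (fun f : {ffun 'I_k -> 'I_p} => \sum_j (f j)%:R * x j) => y.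
(* Adjoin [y] in position 0. By maximality there is a relation, and its coefficient at [y] is prime
   to p because [x] is independent. *)
pose x' (i : 'I_k.+1) := if unlift ord0 i is Some j then x j else y.
have : ~ independent_modp x'.
  by move=> x'ind; have /kmax : P k.+1; [apply/asboolP; exists x' | rewrite ltnn].
move/existsNP => [c /not_implyP[[t]]].
rewrite big_ord_recl /= {1}/x' unlift_none.
under eq_bigr do rewrite /x' liftK.
set c0 := c ord0; pose c' j := c (lift ord0 j).
rewrite -/(\sum_j (c' j)%:R * x j) => cE /existsNP[i ci].
have c0p : coprime p c0.
  rewrite prime_coprime //; apply/negP => /dvdnP[u c0E]; apply: ci.
  have c'p j : (p %| c' j)%N.
    apply: (xind c'); exists (t - u%:R * y).
    rewrite mulrBl -cE c0E natrM -mulrA [p%:R * y]mulrC mulrA [X in X - _]addrC.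
    by rewrite addrK.
  case: (unliftP ord0 i) => [j ->|->]; first exact: c'p.
  by rewrite -/c0 c0E dvdn_mull.
have c0_gt0 : (0 < c0)%N.
  by case: (c0) c0p => //; rewrite /coprime gcdn0 => /eqP p1; move: p_pr; rewrite p1.
have [u v uv _] := egcdnP p c0_gt0; rewrite gcdnC (eqP c0p) in uv.
have p_gt0 := prime_gt0 p_pr.
(* As [u] inverts [c0] mod p, [y] is congruent to the combination with coefficients [- u * c' j];
   the factor [p.-1] stands for -1 among natural numbers. *)
pose e j := (p.-1 * (u * c' j))%N.
exists [ffun j => Ordinal (ltn_pmod (e j) p_gt0)].
(* The multiple of p collects the carries of [e j], the right side of the relation and the error in
   u c0 = v p + 1. *)
exists (\sum_j ((e j %/ p)%N%:R - (u * c' j)%:R) * x j + u%:R * t - v%:R * y).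
have uvR : u%:R * c0%:R = v%:R * p%:R + 1 :> O by rewrite -!natrM uv natrD.
have uS : - (u%:R * \sum_j (c' j)%:R * x j) =
    \sum_j (e j %% p)%N%:R * x j +
    (\sum_j ((e j %/ p)%N%:R - (u * c' j)%:R) * x j) * p%:R.
  rewrite mulr_suml -big_split mulr_sumr -sumrN; apply: eq_bigr => j _ /=.
  rewrite mulrA -natrM -mulNr mulrAC -mulrDl; congr (_ * _).
  rewrite mulrBl addrA -!natrM -natrD [(_ %% _ + _)%N]addnC -divn_eq.
  have <- : (e j + u * c' j = u * c' j * p)%N.
    by rewrite /e -mulSnr prednK // mulnC.
  by rewrite natrD opprD addrA subrr sub0r.
under eq_bigr do rewrite ffunE.
rewrite /= mulrBl mulrDl !addrA -uS -[t in _ * t * _]mulr1.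
rewrite -(mulrA u%:R) -(mulrA t) mul1r -cE mulrDr addrA [X in X - _]addrAC.
rewrite addNr add0r mulrA uvR mulrDl mul1r addrC addrA -mulrA [y * _]mulrC mulrA addNr.
by rewrite add0r.
Qed.

(** [a] divides a power of p, and finiteness passes to products and to divisors. *)
Lemma finite_residues_integers (a : O) : a <> 0 -> finite_residues a.
Proof.
case/integers_dvd_pexp => n [b baE]; apply: (@finite_residues_dvd _ _ b).
rewrite baE natrX; elim: n {baE} => [|n IHn].
  by rewrite expr0; exact: finite_residues1.
by rewrite exprS; apply: finite_residuesM IHn; exact: finite_residues_p.
Qed.

End ResidueRing.

(** * Factorization and ideals in O by powers of a uniformizer *)

Section Uniformizer.
Variables (p : nat) (p_pr : prime p) (E : fieldExtType (padic p_pr)).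
Local Notation O := (integers E).
Variable w : O.
Hypotheses (w_unif : uniformizer w) (w0 : w <> 0).

Lemma noninvertibleP (x : O) : ~ invertible x <-> exists y, x = y * w.
Proof. by have /(congr1 (@^~ x))/= := w_unif; rewrite /principal /= => ->. Qed.

Lemma uniformizer_noninvertible : ~ invertible w.
Proof. by apply/noninvertibleP; exists 1; rewrite mul1r. Qed.

Lemma integers_mulIf (a b c : O) : c <> 0 -> a * c = b * c -> a = b.
Proof.
move=> c0 /eqP; rewrite -subr_eq0 -mulrBl => /eqP/integers_mul_eq0[] // /eqP.
by rewrite subr_eq0 => /eqP.
Qed.

Lemma uniformizer_exp_neq0 n : w ^+ n <> 0.
Proof.
elim: n => [|n IHn]; first by apply/eqP; rewrite expr0 oner_neq0.
by rewrite exprS => /integers_mul_eq0[].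
Qed.

(* Two powers of [w] are congruent mod [a], and [1 - w ^+ k] is invertible for k > 0. *)
Lemma dvd_uniformizer_exp (a : O) : a <> 0 -> exists n b, w ^+ n = b * a.
Proof.
case/finite_residues_integers => I [r rP].
have /choice[f /choice[g fg]] (i : 'I_#|I|.+1) := rP (w ^+ i).
have : ~~ injectiveb f.
  apply/negP => /injectiveP/leq_card; rewrite card_ord ltnn //.
case/injectivePn => i [j ij fij].
wlog ltij : i j ij fij / (i < j)%N.
  by move=> H; move: (ij); rewrite -val_eqE neq_ltn => /orP[/H|/H]; apply;
    rewrite // eq_sym.
have : w ^+ i * (1 - w ^+ (j - i)) = (g i - g j) * a.
  rewrite mulrBr mulr1 -exprD subnKC 1?ltnW // (fg i) (fg j) fij mulrBl.
  by rewrite opprD addrACA subrr add0r.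
have [v vw] : invertible (1 - w ^+ (j - i)).
  (* If [w] divided 1 - w^k with k > 0, it would divide 1. *)
  apply: contrapT => /noninvertibleP[y yE].
  apply: uniformizer_noninvertible; exists (y + w ^+ (j - i).-1).
  by rewrite mulrDl -yE -exprSr prednK ?subn_gt0 // subrK.
move/(congr1 ( *%R v)); rewrite mulrCA vw mulr1 => wi.
by exists i, (v * (g i - g j)); rewrite wi mulrA.
Qed.

(** If m < n, cancelling [w ^+ m] would make [w] invertible. *)
Lemma uniformizer_exp_noninvertible m n b : w ^+ m = b * w ^+ n -> (n <= m)%N.
Proof.
move=> mn; rewrite leqNgt; apply/negP => lt_mn; apply: uniformizer_noninvertible.
exists (b * w ^+ (n - m).-1); apply: (@integers_mulIf _ _ (w ^+ m)).
  exact: uniformizer_exp_neq0.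
by rewrite -(mulrA b) -exprSr prednK ?subn_gt0 // -mulrA -exprD subnK 1?ltnW // mul1r.
Qed.

(** [n] is the largest exponent with [w ^+ n] dividing [a], bounded because [a] divides a power of
    [w]; maximality makes the cofactor invertible. *)
Lemma integers_uniformizer_exp (a : O) : a <> 0 ->
  exists n u, a = u * w ^+ n /\ invertible u.
Proof.
move=> a0; have [m [b bE]] := dvd_uniformizer_exp a0.
pose P n := `[< exists u, a = u * w ^+ n >].
have P0 : exists n, P n by exists 0%N; apply/asboolP; exists a; rewrite expr0 mulr1.
have Pm n : P n -> (n <= m)%N.
  move=> /asboolP[u aE]; apply: (@uniformizer_exp_noninvertible _ _ (b * u)).
  by rewrite -mulrA -aE.
have [n /asboolP[u aE] nmax] := ex_maxnP P0 Pm.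
exists n, u; split=> //; apply: contrapT => /noninvertibleP[y yE].
have /nmax : P n.+1 by apply/asboolP; exists y; rewrite exprS mulrA -yE.
by rewrite ltnn.
Qed.

(** The generator is the least power of [w] in [I], since nonzero elements are units times powers of
    [w]. *)
Lemma integers_ideal_principal (I : set O) a : ideal I -> I a -> a <> 0 ->
  exists b, [/\ b <> 0, I b & forall x, I x -> exists c, x = c * b].
Proof.
move=> [I0 ID IM] Ia a0.
have Iw x n u : I x -> x = u * w ^+ n -> invertible u -> I (w ^+ n).
  by move=> Ix xE [v vu]; have := IM v _ Ix; rewrite xE mulrA vu mul1r.
pose P n := `[< I (w ^+ n) >].
have P0 : exists n, P n.
  have [n [u [aE u1]]] := integers_uniformizer_exp a0.
  by exists n; apply/asboolP; exact: Iw aE u1.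
have [n /asboolP In nmin] := ex_minnP P0.
exists (w ^+ n); split=> // [|x Ix]; first exact: uniformizer_exp_neq0.
have [->|/eqP x0] := eqVneq x 0; first by exists 0; rewrite mul0r.
have [m [u [xE u1]]] := integers_uniformizer_exp x0.
have /nmin nm : P m by apply/asboolP; exact: Iw xE u1.
by exists (u * w ^+ (m - n)); rewrite -mulrA -exprD subnK.
Qed.

End Uniformizer.

(** * Orders of cokernels *)

Lemma order_of_surj (T U : choiceType) (f : T -> U) :
  (forall u, exists t, f t = u) -> finite_set [set: T] ->
  finite_set [set: U] /\ (order_of U <= order_of T)%N.
Proof.
move=> fsurj Tfin; have fT : [set: U]%classic = (f @` [set: T])%classic.
  by apply/seteqP; split=> // u _; have [t <-] := fsurj u; exists t.
split; first by rewrite fT; exact: finite_image.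
rewrite /order_of fT fset_set_image //; exact: leq_trans (leq_imfset_card _ _ _) _.
Qed.

Lemma coker_eq (U V : zmodType) (f : {additive U -> V}) (v v' : V) :
  (\pi_(coker f) v = \pi_(coker f) v')%qT <-> exists u, f u = v - v'.
Proof.
have E : (v - v' \in image_pred f) = (\pi_(coker f) v == \pi_(coker f) v')%qT.
  exact: Quotient.idealrBE.
split=> [/eqP|[u fu]]; first by rewrite -E => /asboolP.
by apply/eqP; rewrite -E; apply/asboolP; exists u.
Qed.

(** [g] carries the image of [f] into that of [f'], so it induces a surjection of cokernels. *)
Lemma coker_order_le (U V U' V' : zmodType) (f : {additive U -> V})
    (f' : {additive U' -> V'}) (g : V -> V') : zmod_morphism g ->
  (forall v', exists v, g v = v') -> (forall u, exists u', f' u' = g (f u)) ->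
  finite_set [set: coker f] ->
  finite_set [set: coker f'] /\ (order_of (coker f') <= order_of (coker f))%N.
Proof.
move=> gB gsurj gf.
apply: (order_of_surj (f := fun x => (\pi_(coker f') (g (repr x)))%qT)).
elim/quotW => v'; have [v gv] := gsurj v'.
exists (\pi v)%qT; apply/coker_eq; rewrite -gv -gB.
have /coker_eq[u <-] : (\pi_(coker f) (repr (\pi_(coker f) v)) = \pi_(coker f) v)%qT.
  by rewrite reprK.
exact: gf.
Qed.

Lemma finite_quo_principal (A : comNzRingType) (a : A) :
  finite_residues a -> finite_set [set: quo_principal a].
Proof.
case=> I [r rP].
have -> : [set: quo_principal a]%classic =
    range (fun i => (\pi_(quo_principal a) (r i))%qT).
  apply/seteqP; split=> // x _; elim/quotW: x => x.
  have [i [y xE]] := rP x; exists i => //; apply/coker_eq; exists (- y).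
  by rewrite xE opprD addrA subrr sub0r /= mulrN mulrC.
by apply: finite_image; exact: finite_finset.
Qed.

(** * The annihilator of the kernel of the augmentation *)

Lemma finitely_generated_integral (A : comNzRingType) (B : comAlgType A) (x : B) :
  finitely_generated (B : lmodType A) ->
  exists2 P : {poly A}, P \is monic & root (map_poly (in_alg B) P) x.
Proof.
case=> n [g gP]; have /choice[z zE] i := gP (x * g i); have [c oneE] := gP 1.
exists (char_poly (\matrix_(i, j) z i j)); first exact: char_poly_monic.
apply: (char_poly_root (g := g) (c := fun i => in_alg B (c i))) => [i|].
  by rewrite zE; apply: eq_bigr => j _; rewrite mxE mulr_algl.
by rewrite {1}oneE; apply: eq_bigr => j _; rewrite mulr_algl.
Qed.

Section Augmented.
Variables (O : comNzRingType) (R : comAlgType O) (lambda : {lrmorphism R -> O^o}).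

Lemma lambda_alg (a : O) : lambda a%:A = a.
Proof. by rewrite linearZ /= rmorph1 /GRing.scale /= mulr1. Qed.

Lemma aug_kerP (r : R) : lambda (r - (lambda r : O)%:A) = 0.
Proof. by rewrite rmorphB /= lambda_alg subrr. Qed.

(** The difference r - lambda(r) lies in the kernel and hence kills [m]. *)
Lemma ker_torsion_scale (M : lmodType R) (m : M) (r : R) :
  m \in ker_torsion_pred lambda (M := M) -> r *: m = (lambda r : O)%:A *: m.
Proof.
move=> /asboolP/(_ _ (aug_kerP r)) /eqP.
by rewrite scalerBl subr_eq0 => /eqP.
Qed.

(** The projection r |-> r - lambda(r) carries generators of R to generators of the kernel. *)
Lemma aug_ker_span : finitely_generated (R : lmodType O) ->
  exists n (g : 'I_n -> R), (forall i, lambda (g i) = 0) /\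
    forall r, lambda r = 0 -> exists c : 'I_n -> O, r = \sum_i c i *: g i.
Proof.
case=> n [g gP]; exists n, (fun i => g i - (lambda (g i) : O)%:A).
split=> [i|r r0]; first exact: aug_kerP.
have [c rE] := gP r; exists c; rewrite {1}rE; apply/eqP; rewrite -subr_eq0 -sumrB.
under eq_bigr do rewrite -scalerBr opprB addrC subrK scalerA.
rewrite -scaler_suml; suff -> : \sum_i c i * (lambda (g i) : O) = 0 by rewrite scale0r.
rewrite -[RHS]r0 rE raddf_sum; apply: eq_bigr => i _ /=.
by rewrite linearZ.
Qed.

(* If Q has nonzero constant term and [Q(x) x ^+ m = 0], then [Q(x) x = 0] as R is
   reduced, while [lambda (Q x) = Q 0]. *)
Lemma aug_ker_elt_annihilator (x : R) : finitely_generated (R : lmodType O) ->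
  reduced R -> lambda x = 0 -> exists2 s, lambda s <> 0 & s * x = 0.
Proof.
move=> Rfin Rred x0; have [P Pmonic Px] := finitely_generated_integral x Rfin.
have [m [Q [Q0 PE]]] := poly_split_X (monic_neq0 Pmonic).
pose s := (map_poly (in_alg R) Q).[x].
have sxm : s * x ^+ m = 0.
  by move: Px; rewrite /root PE rmorphM rmorphXn /= map_polyX hornerM hornerXn => /eqP.
exists s.
  rewrite /s; have [c ->] := horner_coef0_mod (map_poly (in_alg R) Q) x.
  rewrite rmorphD rmorphM /= x0 mulr0 add0r coef_map /= lambda_alg; exact/eqP.
apply: (Rred _ m.+1).
by rewrite exprMn !exprSr mulrA -(mulrA (s ^+ m)) sxm mulr0 mul0r.
Qed.

(** Multiply the annihilators of finitely many generators of the kernel; their images under [lambda]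
    are nonzero in a domain. *)
Lemma aug_ker_annihilator : (forall a b : O, a * b = 0 -> a = 0 \/ b = 0) ->
  finitely_generated (R : lmodType O) -> reduced R ->
  exists2 s, lambda s <> 0 & forall r, lambda r = 0 -> r * s = 0.
Proof.
move=> O_idomain Rfin Rred; have [n [g [g0 gP]]] := aug_ker_span Rfin.
have /choice[t /all_and2[t0 tg]] i : exists t, lambda t <> 0 /\ t * g i = 0.
  by have [t t0 tg] := aug_ker_elt_annihilator Rfin Rred (g0 i); exists t.
exists (\prod_i t i).
  elim/big_rec: _ => [|i y _ y0]; first by rewrite rmorph1; apply/eqP/oner_neq0.
  by rewrite rmorphM => /O_idomain[/t0|].
move=> r /gP[c ->]; rewrite mulr_suml big1 // => i _.
by rewrite (bigD1 i) //= -scalerAl mulrA [g i * _]mulrC tg mul0r scaler0.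
Qed.

(* [R[ker lambda]] meets [ker lambda] in elements of square zero. *)
Lemma ker_torsion_lambda_inj (t t' : R^o) : reduced R ->
  t \in ker_torsion_pred lambda (M := R^o) -> t' \in ker_torsion_pred lambda (M := R^o) ->
  lambda t = lambda t' -> t = t'.
Proof.
move=> Rred tK t'K tt'; apply/eqP; rewrite -subr_eq0; apply/eqP/(Rred _ 2).
have /asboolP := rpredB tK t'K; apply; by rewrite rmorphB /= tt' subrr.
Qed.

(* For x in the kernel, [lambda s * x = (lambda s - s) * x] lies in its square. *)
Lemma finite_cotangent (s : R) : finitely_generated (R : lmodType O) ->
  (forall r, lambda r = 0 -> r * s = 0) -> finite_residues (lambda s : O) ->
  finite_set [set: cotangent lambda].
Proof.
move=> Rfin Ks [I [r rP]]; have [n [g [g0 gP]]] := aug_ker_span Rfin.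
have comb_ker (c : 'I_n -> O) : \sum_i c i *: g i \in aug_ker_pred lambda.
  rewrite unfold_in raddf_sum big1 // => i _ /=.
  by rewrite linearZ /= g0 scaler0.
pose comb c := AugKer (comb_ker c).
pose cls (f : {ffun 'I_n -> I}) := (\pi_(cotangent lambda) (comb (r \o f)))%qT.
suff -> : [set: cotangent lambda]%classic = range cls.
  by apply: finite_image; exact: finite_finset.
apply/seteqP; split=> // x _; elim/quotW: x => -[x x_ker].
have x0 : lambda x = 0 by exact/eqP.
have [c xE] := gP _ x0.
have /choice[f /choice[y fy]] i := rP (c i).
exists (finfun f) => //; apply/eqP; rewrite -Quotient.idealrBE.
apply/asboolP.
have k_ker : s - (lambda s : O)%:A \in aug_ker_pred lambda.
  by rewrite unfold_in aug_kerP.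
(* The two representatives differ by the single product of s - lambda(s) and [comb y]. *)
exists 1%N, (fun=> AugKer k_ker), (fun=> comb y).
rewrite big_ord1 /= xE.
have -> : (s - (lambda s : O)%:A) * \sum_i y i *: g i =
    - ((lambda s : O) *: \sum_i y i *: g i).
  rewrite mulrBl mulr_algl [s * _]mulrC Ks ?sub0r //.
  by apply/eqP; exact: comb_ker.
rewrite scaler_sumr -sumrB -sumrN; apply: eq_bigr => i _; rewrite ffunE fy.
by rewrite scalerDl opprD addrA subrr sub0r scalerA [y i * _]mulrC.
Qed.

Lemma dual_alg (M : lmodType R) (f : dual_hom M) (a : O) (m : M) :
  f (a%:A *: m) = a * (f m : O).
Proof. exact: (linearZ_LR (f : Defs.hom (res M) O^o) a (m : res M)). Qed.

Lemma dualD (M : lmodType R) (f : dual_hom M) (m n : M) : f (m + n) = (f m : O) + f n.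
Proof. exact: (raddfD (f : Defs.hom (res M) O^o) (m : res M) n). Qed.

Lemma dualB (M : lmodType R) (f : dual_hom M) (m n : M) : f (m - n) = (f m : O) - f n.
Proof. exact: (raddfB (f : Defs.hom (res M) O^o) (m : res M) n). Qed.

Lemma dual0 (M : lmodType R) (f : dual_hom M) : f (0 : M) = 0 :> O.
Proof. exact: (raddf0 (f : Defs.hom (res M) O^o)). Qed.

Lemma dual_ker_torsion (M : lmodType R) (f : dual_hom M) (r : R) (m : M) :
  f \in ker_torsion_pred lambda (M := dual M) -> f (r *: m) = (lambda r : O) * (f m : O).
Proof.
move=> fK; rewrite -dual_alg.
by have /(congr1 (fun h : dual_hom M => h m)) := ker_torsion_scale r fK.
Qed.

(** [m1] witnesses that [f0] maps onto O. *)
Definition torsion_basis (M : lmodType R) (m0 m1 : M) (f0 : dual_hom M) :=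
  [/\ m0 \in ker_torsion_pred lambda (M := M),
      forall m, m \in ker_torsion_pred lambda (M := M) -> exists c : O, m = c%:A *: m0,
      f0 \in ker_torsion_pred lambda (M := dual M),
      forall f : dual_hom M, f \in ker_torsion_pred lambda (M := dual M) ->
        exists c : O, forall m, f m = c * (f0 m : O) &
      f0 m1 = 1].

(* Evaluation at [f0] identifies the dual of M^*[ker lambda] with O, with inverse
   [c |-> (f |-> f (c m1))], and maps the image of M[ker lambda] onto [O f0(m0)]. *)
Lemma congruence_module_order (M : lmodType R) (m0 m1 : M) (f0 : dual_hom M) :
  torsion_basis m0 m1 f0 -> finite_set [set: quo_principal (f0 m0 : O)] ->
  finite_set [set: congruence_module lambda M] /\
  order_of (congruence_module lambda M) = order_of (quo_principal (f0 m0 : O)).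
Proof.
move=> [m0K m0gen f0K f0gen f0m1] fin.
pose F0 : ker_torsion lambda (dual M) := KerTorsion f0K.
pose ev (phi : dual (ker_torsion lambda (dual M))) : O :=
  (phi : dual_hom (ker_torsion lambda (dual M))) F0.
pose g (c : O) : dual (ker_torsion lambda (dual M)) :=
  dual_map (@ker_torsion_val O R lambda (dual M)) (bidual (c%:A *: m1)).
have evg c : ev (g c) = c by rewrite /ev /g /= dual_alg f0m1 mulr1.
have evB : zmod_morphism ev by [].
have ev_inj phi psi : ev phi = ev psi -> phi = psi.
  move=> evE; apply: dualP => -[f fK].
  have [c fE] := f0gen f fK.
  have -> : KerTorsion fK = c%:A *: F0.
    by apply/val_inj/dualP => m; rewrite fE -[in LHS]dual_alg.
  by rewrite !dual_alg [X in _ * X = _]evE.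
have gB : zmod_morphism g by move=> c d; apply: ev_inj; rewrite evB !evg.
have evgK phi : g (ev phi) = phi by apply: ev_inj; rewrite evg.
have [] := @coker_order_le _ _ _ _ ((f0 m0 : O) \*o @idfun O)
  (@congruence_map O R lambda M) g gB.
- by move=> phi; exists (ev phi); rewrite evgK.
- move=> c; exists (c%:A *: KerTorsion m0K); apply: ev_inj; rewrite evg.
  by rewrite /ev /= dual_alg mulrC.
- exact: fin.
move=> fin' le; split=> //; apply/eqP; rewrite eqn_leq le /=.
have [] // := @coker_order_le _ _ _ _ (@congruence_map O R lambda M)
  ((f0 m0 : O) \*o @idfun O) ev evB.
- by move=> c; exists (g c); rewrite evg.
- case=> m mK; have [c mE] := m0gen m mK; exists c.
  by rewrite /ev /= mE dual_alg mulrC.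
Qed.

End Augmented.

(** * The rank over the field of fractions *)

Section Rank.
Variables (p : nat) (p_pr : prime p) (E : fieldExtType (padic p_pr)).
Local Notation O := (integers E).
Local Notation restrictE V := (Defs.restrict (@integers_val p p_pr E) V).

(* Because E is the fraction field of O. *)
Lemma integers_linear_scale (V W : lmodType E) (h : {linear restrictE V -> restrictE W})
    (x : E) (v : V) : h (x *: v) = x *: (h v : W).
Proof.
have [a [c [a0 axc]]] := integers_frac x.
have a_neq0 : (a : E) != 0 by apply: contra_not_neq a0 => a0; apply: val_inj.
apply: (scalerI a_neq0); rewrite scalerA axc.
have hZ (e : O) (u : V) : h ((e : E) *: u) = (e : E) *: (h u : W).
  exact: (linearZ_LR h e (u : restrictE V)).
by rewrite -!hZ scalerA axc.
Qed.

Lemma integers_linear_dim (V W : vectType E) (h : {linear restrictE V -> restrictE W}) :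
  injective h -> (\dim {:V} <= \dim {:W})%N.
Proof.
move=> h_inj; pose hE : V -> W := h.
have hE_lin : linear hE.
  move=> a u v; rewrite /hE -integers_linear_scale.
  exact: (raddfD h (a *: u : restrictE V) v).
pose hL := GRing.isLinear.Build E V W _ hE hE_lin.
pose H : {linear V -> W} := HB.pack hE hL.
have kerH : (lker (linfun H) == 0)%VS.
  by apply/lker0P => u v; rewrite !lfunE; exact: h_inj.
rewrite -(limg_dim_eq (f := linfun H) (U := fullv)) ?dimvS ?subvf //.
by rewrite (eqP kerH) capv0.
Qed.

Variables (R : comAlgType O) (lambda : {lrmorphism R -> O^o}).

(** Universality gives an O-linear injection of either tensor product into the other, which bounds
    the dimensions both ways. *)
Lemma has_lambda_rank_uniq (M : lmodType R) d d' :
  has_lambda_rank lambda M d -> has_lambda_rank lambda M d' -> d = d'.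
Proof.
suff H e e' : has_lambda_rank lambda M e -> has_lambda_rank lambda M e' -> (e <= e')%N.
  by move=> hd hd'; apply/eqP; rewrite eqn_leq !H.
move=> [V [b [[bbil buniv] _ <-]]] [W [c [[cbil cuniv] _ <-]]].
have [h [hbc _]] := buniv _ c cbil; have [k [kcb _]] := cuniv _ b bbil.
apply: (integers_linear_dim (h := h)); apply: (can_inj (g := k)) => v.
have [g [_ guniq]] := buniv _ b bbil.
have khE m y : (k \o h) (b m y) = b m y by rewrite /= hbc kcb.
exact: etrans (guniq (k \o h) khE v) (esym (guniq idfun (fun _ _ => erefl) v)).
Qed.

Lemma lambda_rankP (M : lmodType R) d :
  has_lambda_rank lambda M d -> lambda_rank lambda M = d.
Proof. by move=> hd; apply: xget_unique => // e /(has_lambda_rank_uniq hd). Qed.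

(** The default value of [lambda_rank] is 0, so a positive value is a genuine rank. *)
Lemma has_lambda_rank_of (M : lmodType R) d :
  (0 < d)%N -> lambda_rank lambda M = d -> has_lambda_rank lambda M d.
Proof.
rewrite /lambda_rank; case: xgetP => [e -> he _ <- //|_ d0 dE].
by rewrite -dE in d0.
Qed.

(** E itself is the tensor product, the pair (m, y) going to lambda(m) y. *)
Lemma has_lambda_rank_regular (s : R) : reduced R -> lambda s <> 0 ->
  (forall r, lambda r = 0 -> r * s = 0) -> has_lambda_rank lambda R^o 1.
Proof.
move=> Rred s0 Ks; pose N := res (ker_torsion lambda R^o).
have sK : (s : R^o) \in ker_torsion_pred lambda (M := R^o) by apply/asboolP.
pose S : N := KerTorsion sK.
pose b (m : N) (y : restrictE E^o) : restrictE E^o :=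
  ((lambda (ker_torsion_val m) : O) : E) * y.
have s_neq0 : ((lambda s : O) : E) != 0.
  by apply: contra_not_neq s0 => s0; apply: val_inj.
have bDr m : linear (b m).
  by move=> a y z; rewrite /b [LHS]mulrDr; congr (_ + _); exact: mulrCA.
have bDl y : linear (b^~ y).
  move=> a m n; rewrite /b.
  have -> : (lambda (ker_torsion_val (a *: m + n)) : O) =
            a * (lambda (ker_torsion_val m) : O) + (lambda (ker_torsion_val n) : O).
    by rewrite rmorphD rmorphM /= lambda_alg.
  by rewrite rmorphD rmorphM /= mulrDl; congr (_ + _); rewrite -mulrA.
exists E^o, b; split; first split=> //; last exact: dimvf.
- move=> X c [cl cr]; pose t : E := ((lambda s : O) : E)^-1.
  have cZl m a y : c (a *: m) y = a *: c m y.
    exact: (scalable_linear (cr y) a m).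
  have cZr m (a : O) y : c m ((a : E) * (y : E)) = a *: c m y.
    exact: (scalable_linear (cl m) a y).
  (* Since [b S y] is lambda(s) y, this is the only possible factorization of [c]. *)
  pose h (y : restrictE E^o) : X := c S (t * y).
  have h_lin : linear h.
    move=> a y z; rewrite /h -cl; congr (c S _).
    by rewrite [LHS]mulrDr; congr (_ + _); exact: mulrCA.
  pose H : {linear restrictE E^o -> X} :=
    HB.pack h (GRing.isLinear.Build O _ X _ h h_lin).
  exists H; split.
    move=> m y; rewrite /= /h /b mulrCA cZr -cZl.
    (* Both sides lie in R[ker lambda] and have the same image under [lambda]. *)
    have -> : (lambda (ker_torsion_val m) : O) *: S = (lambda s : O) *: m.
      apply/val_inj/(ker_torsion_lambda_inj Rred); try exact: valP.
      by rewrite !rmorphM /= !lambda_alg mulrC.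
    by rewrite cZl -cZr mulrA divff // mul1r.
  by move=> h' h'E y; rewrite /= /h -h'E /b mulrA divff // mul1r.
- by move=> m x y; rewrite /b /= mulrCA.
Qed.

End Rank.

(** * Generators of M[ker lambda] and of its dual counterpart in rank one *)

Section RankOne.
Variables (p : nat) (p_pr : prime p) (E : fieldExtType (padic p_pr)).
Local Notation O := (integers E).
Local Notation restrictE V := (Defs.restrict (@integers_val p p_pr E) V).
Variables (R : comAlgType O) (lambda : {lrmorphism R -> O^o}).
Variable (M : lmodType R).
Hypothesis bidual_inj : injective (@bidual O R M).
Local Notation torsion := (ker_torsion_pred lambda (M := M)).
Local Notation dual_torsion := (ker_torsion_pred lambda (M := dual M)).

Lemma dual_hom_eq0 (m : M) : (forall f : dual_hom M, f m = 0) -> m = 0.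
Proof.
move=> fm; apply: bidual_inj; apply: dualP => f /=.
by rewrite fm dual0.
Qed.

Lemma dual_hom_mk (h : M -> O) : (forall a m n, h (a%:A *: m + n) = a * h m + h n) ->
  exists f : dual_hom M, forall m, f m = h m.
Proof.
move=> h_lin; have hP : h \in @linear_pred O (res M) O^o.
  by apply/asboolP => a m n; exact: h_lin.
by exists (Defs.Hom hP).
Qed.

(** M[ker lambda] embeds in the line [V], so its elements are proportional over E, and over O after
    clearing denominators. *)
Lemma rank_one_torsion : has_lambda_rank lambda M 1 ->
  (exists2 m, m \in torsion & m <> 0) /\
  forall m m', m \in torsion -> m' \in torsion ->
    m' <> 0 -> exists (a c : O), a <> 0 /\ a%:A *: m = c%:A *: m'.
Proof.
move=> [V [b [[[bl br] buniv] _ Vdim]]].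
pose N := res (ker_torsion lambda M).
(* The bilinear map f(n) y factors through [b], so every functional vanishes at [m] when [b m 1]
   does. *)
have b_inj (m : N) : b m 1 = 0 -> ker_torsion_val m = 0.
  move=> bm0; apply: dual_hom_eq0 => f.
  pose c (n : N) (y : restrictE E^o) : restrictE E^o :=
    ((f (ker_torsion_val n) : O) : E) * y.
  have cbil : bilinear_map c.
    split=> [n a y z|y a n n'].
      by rewrite /c [LHS]mulrDr; congr (_ + _); exact: mulrCA.
    rewrite /c.
    have -> : (f (ker_torsion_val (a *: n + n')) : O) =
        a * (f (ker_torsion_val n) : O) + (f (ker_torsion_val n') : O).
      by rewrite -dual_alg -dualD.
    by rewrite rmorphD rmorphM /= mulrDl; congr (_ + _); rewrite -mulrA.
  have [h [hbc _]] := buniv _ c cbil.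
  by apply: val_inj; rewrite /= -[LHS]mulr1 -[LHS]/(c m 1) -hbc bm0 raddf0.
split.
  (* If M[ker lambda] were 0, [b] would be 0; the identity and the zero map would both factor it,
     forcing V = 0. *)
  apply: contrapT => tors0.
  have N0 (m : N) : m = 0.
    apply: val_inj => /=; apply: contrapT => m0; apply: tors0.
    by exists (ker_torsion_val m) => //; exact: valP.
  have b0 m y : b m y = 0.
    have mE : m = 0 *: m by rewrite scale0r (N0 m).
    by rewrite mE; apply: etrans (scalable_linear (br y) 0 m) _; exact: scale0r.
  have [h [_ huniq]] := buniv _ b (conj bl br).
  have V0 (v : V) : v = 0.
    apply: etrans (huniq idfun (fun _ _ => erefl) v) _.
    by rewrite -(huniq \0 (fun m y => esym (b0 m y)) v).
  have : (\dim {:V} <= \dim (0 : {vspace V}))%N.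
    by apply/dimvS/subvP => v _; rewrite (V0 v) mem0v.
  by rewrite Vdim dimv0.
move=> m m' mK m'K m'0; pose m1 : N := KerTorsion mK; pose m1' : N := KerTorsion m'K.
pose v : V := b m1 1; pose v' : V := b m1' 1.
have v'0 : v' != 0 by apply: contra_not_neq m'0 => /b_inj.
have /vlineP[x vE] : v \in <[v']>%VS.
  suff -> : <[v']>%VS = fullv by rewrite memvf.
  by apply/eqP; rewrite eqEdim subvf Vdim dim_vline v'0.
have [a [c [a0 axc]]] := integers_frac x; exists a, c; split=> //.
apply/eqP; rewrite -subr_eq0; apply/eqP.
apply: (b_inj (a *: m1 - c *: m1')).
have -> : b (a *: m1 - c *: m1') 1 = a *: b m1 1 - c *: b m1' 1.
  by rewrite (zmod_morphism_linear (br 1)) !(scalable_linear (br 1)).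
apply/eqP; rewrite subr_eq0; apply/eqP.
rewrite -[LHS]/((a : E) *: v) -[RHS]/((c : E) *: v').
by rewrite vE scalerA axc.
Qed.

Lemma dual_torsion_free (a : O) (m : M) : a <> 0 -> a%:A *: m = 0 -> m = 0.
Proof.
move=> a0 am0; apply: dual_hom_eq0 => f.
have : a * (f m : O) = 0 by rewrite -dual_alg am0 dual0.
by case/integers_mul_eq0.
Qed.

Variables (w : O) (s : R).
Hypotheses (w_unif : uniformizer w) (w0 : w <> 0).
Hypotheses (s0 : lambda s <> 0) (Ks : forall r, lambda r = 0 -> r * s = 0).

Lemma killer_torsion (m : M) : s *: m \in torsion.
Proof. by apply/asboolP => r /Ks rs; rewrite scalerA rs scale0r. Qed.

(** By proportionality, a functional nonzero at one torsion element is injective on M[ker lambda],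
    which is thus isomorphic to a principal ideal of O. *)
Lemma torsion_generator : has_lambda_rank lambda M 1 ->
  exists m0, [/\ m0 <> 0, m0 \in torsion &
    forall m, m \in torsion -> exists c : O, m = c%:A *: m0].
Proof.
case/rank_one_torsion => -[m mK m_neq0] dep.
have [f fm] : exists f : dual_hom M, f m <> 0.
  by apply/existsNP => fm; apply: m_neq0; exact: dual_hom_eq0.
have f_inj x : x \in torsion -> f x = 0 -> x = 0.
  move=> xK fx; have [a [c [a0 ax]]] := dep x m xK mK m_neq0.
  have : c * (f m : O) = 0 by rewrite -dual_alg -ax dual_alg fx mulr0.
  case/integers_mul_eq0 => // c0; apply: (dual_torsion_free a0).
  by rewrite ax c0 !scale0r.
pose I : set O := (fun a => exists2 x, x \in torsion & f x = a).
have I_ideal : ideal I.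
  split=> [|_ _ [x xK <-] [y yK <-]|a _ [x xK <-]].
  - by exists 0; rewrite ?rpred0 ?dual0.
  - by exists (x + y); rewrite ?rpredD ?dualD.
  - by exists (a%:A *: x); rewrite ?rpredZ // dual_alg.
have Ifm : I (f m : O) by exists m.
have [b [b0 [m0 m0K fm0] Igen]] := integers_ideal_principal w_unif w0 I_ideal Ifm fm.
exists m0; split=> // [m00|x xK]; first by apply: b0; rewrite -fm0 m00 dual0.
have [c fx] : exists c, (f x : O) = c * b by apply: Igen; exists x.
exists c; apply/eqP; rewrite -subr_eq0; apply/eqP/f_inj.
  by rewrite rpredB ?rpredZ.
by rewrite dualB dual_alg fm0 fx subrr.
Qed.

(** Evaluation at [m0] embeds the torsion of the dual in O as an ideal; [f0] lies over a
    generator. *)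
Lemma torsion_basis_exists : has_lambda_rank lambda M 1 ->
  exists m0 m1 (f0 : dual_hom M), torsion_basis lambda m0 m1 f0 /\ f0 m0 <> 0.
Proof.
case/torsion_generator => m0 [m0_neq0 m0K m0gen].
have [f fm0] : exists f : dual_hom M, f m0 <> 0.
  by apply/existsNP => fm0; apply: m0_neq0; exact: dual_hom_eq0.
pose I : set O := (fun a => exists2 g : dual_hom M, g \in dual_torsion & g m0 = a).
have I_ideal : ideal I.
  split=> [|_ _ [g gK <-] [h hK <-]|a _ [g gK <-]].
  - by exists (0 : dual M); rewrite ?rpred0.
  - by exists (g + h : dual M); rewrite ?rpredD.
  - by exists (a%:A *: g : dual M); rewrite ?rpredZ //= dual_alg.
(* Multiplication by [s] moves [f] into the torsion of the dual and multiplies its value at [m0] by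
   the nonzero [lambda s]. *)
pose sf : dual_hom M := (s *: (f : dual M)).
have sfK : sf \in dual_torsion by apply/asboolP => r /Ks rs; rewrite scalerA rs scale0r.
have sfm0 : (sf m0 : O) <> 0.
  by rewrite /= (ker_torsion_scale s m0K) dual_alg => /integers_mul_eq0[].
have Isf : I (sf m0 : O) by exists sf.
have [b [b0 [f0 f0K f0m0] Igen]] := integers_ideal_principal w_unif w0 I_ideal Isf sfm0.
have f0gen (g : dual_hom M) : g \in dual_torsion ->
    exists c : O, forall m, (g m : O) = c * (f0 m : O).
  move=> gK; have [c gm0] : exists c, (g m0 : O) = c * b by apply: Igen; exists g.
  (* As lambda(s) g(m) = g(s m) and s m is a multiple of [m0], the value at [m0] determines [g]. *)
  exists c => m; have [d smE] := m0gen _ (killer_torsion m).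
  have : (lambda s : O) * ((g m : O) - c * (f0 m : O)) = 0.
    rewrite mulrBr mulrCA -!dual_ker_torsion // smE !dual_alg gm0 f0m0.
    by rewrite mulrCA subrr.
  by case/integers_mul_eq0 => // /eqP; rewrite subr_eq0 => /eqP.
have [[m1 [v vm1]]|f0N] := pselect (exists m, invertible (f0 m : O)).
  exists m0, (v%:A *: m1), f0; split; last by rewrite f0m0.
  by split=> //; rewrite dual_alg.
(* Without an invertible value, [f0] is [w] times a functional [h], again killed by the kernel; then
   h = c f0 gives c w = 1. *)
have /choice[h hE] m : exists a, (f0 m : O) = a * w.
  by apply/(noninvertibleP w_unif) => f0m; apply: f0N; exists m.
have [|g gE] := @dual_hom_mk h.
  move=> a m n; apply: (integers_mulIf w0).
  by rewrite mulrDl -mulrA -!hE -dual_alg dualD.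
have gK : g \in dual_torsion.
  apply/asboolP => r r0; apply: dualP => m; apply: (integers_mulIf w0).
  rewrite /= gE mul0r -hE.
  by rewrite (dual_ker_torsion r m f0K) r0 mul0r.
have [c gc] := f0gen g gK; case: (uniformizer_noninvertible w_unif).
exists c; apply: (integers_mulIf b0).
rewrite -f0m0 mul1r mulrAC -gc gE.
by rewrite -hE.
Qed.

End RankOne.

(** * Comparison of congruence modules *)

Section Comparison.
Variables (O : comNzRingType) (R : comAlgType O) (lambda : {lrmorphism R -> O^o}).

(** Serves twice: on M for the inequality, and on R for its converse when [homothety] is
    bijective. *)
Lemma torsion_basis_dvd (M : lmodType R) (m0 m1 : M) (f0 : dual_hom M) (s : R) :
  torsion_basis lambda m0 m1 f0 -> (forall r, lambda r = 0 -> r * s = 0) ->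
  exists c, (lambda s : O) = c * (f0 m0 : O).
Proof.
move=> [_ m0gen f0K _ f0m1] Ks.
have [|c sm1] := m0gen (s *: m1).
  by apply/asboolP => r /Ks rs; rewrite scalerA rs scale0r.
by exists c; rewrite -dual_alg -sm1 (dual_ker_torsion s m1 f0K) f0m1 mulr1.
Qed.

(* The R-linear endomorphism [m |-> f0 m *: m0] is multiplication by some t, which is
   killed by [ker lambda], and [lambda t = f0 m0]. *)
Lemma torsion_basis_homothety (M : lmodType R) (m0 m1 : M) (f0 : dual_hom M) :
  torsion_basis lambda m0 m1 f0 -> (forall a : O, a%:A *: m0 = 0 -> a = 0) ->
  bijective (@homothety R M) ->
  exists2 t, (lambda t : O) = f0 m0 & forall r, lambda r = 0 -> r * t = 0.
Proof.
move=> [m0K m0gen f0K _ f0m1] m0_free hom_bij.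
pose phi (m : M) : M := (f0 m : O)%:A *: m0.
(* R acts on both [f0] and [m0] through [lambda]. *)
have phi_lin : phi \in @linear_pred R M M.
  apply/asboolP => r m n; rewrite /phi dualD (dual_ker_torsion r m f0K).
  rewrite scalerDl scalerDl; congr (_ + _).
  rewrite [in RHS]scalerA [r * _]mulrC -[in RHS]scalerA (ker_torsion_scale r m0K).
  by rewrite [RHS]scalerA -scalerAl mul1r scalerA [(f0 m : O) * _]mulrC.
have [inv homK invK] := hom_bij; pose t := inv (Defs.Hom phi_lin).
have tE m : t *: m = (f0 m : O)%:A *: m0.
  by have /(congr1 (fun h : Defs.hom M M => h m)) := invK (Defs.Hom phi_lin).
have tK r : lambda r = 0 -> r * t = 0.
  move=> r0; apply: (bij_inj hom_bij); apply: val_inj; apply: funext => m /=.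
  rewrite -scalerA tE scale0r scalerA mulrC -scalerA.
  by have /asboolP/(_ r r0) -> := m0K; rewrite scaler0.
exists t => //; apply/eqP; rewrite -subr_eq0; apply/eqP/m0_free.
by rewrite !scalerBl -tE (ker_torsion_scale t m0K) subrr.
Qed.

Lemma order_quo_principal_dvd (a b : O) : (exists c, b = c * a) ->
  finite_set [set: quo_principal b] ->
  (order_of (quo_principal a) <= order_of (quo_principal b))%N.
Proof.
move=> [c ->] fin.
have [] // := @coker_order_le _ _ _ _ ((c * a) \*o @idfun O) (a \*o @idfun O) idfun.
- by move=> v; exists v.
- by move=> u; exists (c * u) => /=; rewrite mulrCA mulrA.
Qed.

End Comparison.

(** * The case of R as a module over itself *)

Section RegularModule.
Variables (p : nat) (p_pr : prime p) (E : fieldExtType (padic p_pr)).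
Local Notation O := (integers E).
Variables (R : comAlgType O) (lambda : {lrmorphism R -> O^o}).

(** The functional is [lambda] itself, since f(r) = lambda(r) f(1) for f in the torsion of the dual;
    [t] lies over a generator of the ideal lambda(R[ker lambda]). *)
Lemma torsion_basis_regular (w : O) (s : R) : uniformizer w -> w <> 0 -> reduced R ->
  lambda s <> 0 -> (forall r, lambda r = 0 -> r * s = 0) ->
  exists (t : R^o) (l : dual_hom R^o), [/\ torsion_basis lambda t 1 l,
    forall r, l r = lambda r, lambda t <> 0 & forall r, lambda r = 0 -> r * t = 0].
Proof.
move=> w_unif w0 Rred s0 Ks.
pose I : set O := (fun a =>
  exists2 x : R^o, x \in ker_torsion_pred lambda (M := R^o) & lambda x = a).
have I_ideal : ideal I.
  split=> [|_ _ [x xK <-] [y yK <-]|a _ [x xK <-]].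
  - by exists 0; rewrite ?rpred0 ?raddf0.
  - by exists (x + y); rewrite ?rpredD ?raddfD.
  - by exists (a%:A *: x); rewrite ?rpredZ // rmorphM /= lambda_alg.
have sK : (s : R^o) \in ker_torsion_pred lambda (M := R^o) by apply/asboolP.
have Is : I (lambda s : O) by exists (s : R^o).
have [b [b0 [t tK lt] Igen]] := integers_ideal_principal w_unif w0 I_ideal Is s0.
have [|l lE] := @dual_hom_mk _ _ _ R R^o (fun r : R^o => lambda r : O).
  by move=> a m n; rewrite rmorphD rmorphM /= lambda_alg.
exists t, l; split=> //; last 2 first.
- by rewrite lt.
- by move=> r r0; have /asboolP/(_ r r0) := tK.
split=> //.
- move=> x xK; have [c xE] : exists c, (lambda x : O) = c * b by apply: Igen; exists x.
  exists c; apply: (ker_torsion_lambda_inj Rred xK); first by rewrite rpredZ.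
  by rewrite xE rmorphM /= lambda_alg lt.
- apply/asboolP => r r0; apply: dualP => x /=.
  by rewrite lE rmorphM /= r0 mul0r.
- move=> f fK; exists (f (1 : R^o) : O) => r.
  rewrite lE mulrC; have <- := @dual_ker_torsion _ _ lambda R^o f r 1 fK.
  by congr (f _); exact/esym/mulr1.
- by rewrite lE rmorph1.
Qed.

End RegularModule.

Theorem theorem3p12 (RR : realType)
    (p : nat) (p_pr : prime p) (E : fieldExtType (padic p_pr))
    (w : integers E) (hw : uniformizer w)
    (R : comAlgType (integers E))
    (R_local : local_ring R)
    (R_finite : finitely_generated (R : lmodType (integers E)))
    (R_torsion_free : torsion_free w (R : lmodType (integers E)))
    (R_reduced : reduced R)
    (lambda : {lrmorphism R -> (integers E)^o})
    (lambda_surj : forall a : integers E, exists r : R, lambda r = a)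
    (M : lmodType R)
    (M_reflexive : reflexive_module M)
    (M_rank : lambda_rank lambda M = 1%N) :
  [/\ defect_defined lambda R^o /\ defect_defined lambda M,
      (order_of (congruence_module lambda M) <=
         order_of (congruence_module lambda R^o))%N,
      wiles_defect lambda RR R^o <= wiles_defect lambda RR M &
      bijective (@homothety R M) ->
        order_of (congruence_module lambda R^o) =
          order_of (congruence_module lambda M) /\
        wiles_defect lambda RR R^o = wiles_defect lambda RR M].
Proof.
have w0 : w <> 0.
  (* If [w] were 0, torsion-freeness at 1 would give 1 = 0 in R. *)
  move=> w0; have := R_torsion_free 1.
  by rewrite w0 scale0r => /(_ erefl)/eqP; rewrite oner_eq0.
have [s s0 Ks] : exists2 s, lambda s <> 0 & forall r, lambda r = 0 -> r * s = 0.
  by apply: aug_ker_annihilator => //; exact: integers_mul_eq0.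
have R_rank : lambda_rank lambda R^o = 1%N.
  exact/lambda_rankP/(has_lambda_rank_regular R_reduced s0 Ks).
have bidual_inj := bij_inj M_reflexive.2.
have M_has_rank := has_lambda_rank_of (ltn0Sn 0) M_rank.
have [m0 [m1 [f0 [Mbasis fm0]]]] :=
  torsion_basis_exists bidual_inj hw w0 s0 Ks M_has_rank.
have [t [l [Rbasis lE t0 Kt]]] := torsion_basis_regular hw w0 R_reduced s0 Ks.
have quo_fin (a : integers E) : a <> 0 -> finite_set [set: quo_principal a].
  by move=> a0; exact/finite_quo_principal/finite_residues_integers.
have cotangent_fin := finite_cotangent R_finite Ks (finite_residues_integers s0).
have [M_fin M_order] := congruence_module_order Mbasis (quo_fin _ fm0).
have lt0 : (l t : integers E) <> 0 by rewrite lE.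
have [R_fin R_order] := congruence_module_order Rbasis (quo_fin _ lt0).
have M_le_R : (order_of (congruence_module lambda M) <=
               order_of (congruence_module lambda R^o))%N.
  rewrite M_order R_order; apply: order_quo_principal_dvd (quo_fin _ lt0).
  by rewrite lE; exact: torsion_basis_dvd Mbasis Kt.
(* The class of 0 makes the order positive, as comparing logarithms requires. *)
have M_gt0 : (0 < order_of (congruence_module lambda M))%N.
  rewrite /order_of cardfs_gt0; apply/fset0Pn; exists 0.
  by rewrite in_fset_set // in_setT.
have p_fin := finite_quo_principal (finite_residues_p E).
split=> //; first by split; split=> //; rewrite ?R_rank ?M_rank.
  rewrite /wiles_defect R_rank M_rank !mul1r; apply: ler_wpM2r.
    (* O/p has order at least 1, so the common denominator is nonnegative. *)
    rewrite invr_ge0; apply: ln_ge0; rewrite ler1n /order_of cardfs_gt0.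
    by apply/fset0Pn; exists 0; rewrite in_fset_set // in_setT.
  rewrite lerD2l lerN2 ler_ln ?ler_nat // posrE ltr0n //.
  exact: leq_trans M_gt0 M_le_R.
move=> hom_bij.
have m0_free a : a%:A *: m0 = 0 -> a = 0.
  move=> am0; have : a * (f0 m0 : integers E) = 0 by rewrite -dual_alg am0 dual0.
  by case/integers_mul_eq0.
have [u uE Ku] := torsion_basis_homothety Mbasis m0_free hom_bij.
have R_eq_M : order_of (congruence_module lambda R^o) =
              order_of (congruence_module lambda M).
  apply/eqP; rewrite eqn_leq M_le_R andbT M_order R_order.
  apply: order_quo_principal_dvd (quo_fin _ fm0).
  (* [u] is killed by the kernel and lambda(u) = f0(m0), so l(t) divides f0(m0). *)
  have [c uc] := torsion_basis_dvd Rbasis Ku.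
  by exists c; rewrite -uE.
by rewrite /wiles_defect R_rank M_rank R_eq_M.
Qed.
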